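(* Let $m\geq1$ be a fixed integer and $s\in\mathbb{C}$ with $\Re(s)=\sigma>1$. Then the spectrum $$F(\sigma)=\lim_{x\to\infty}\frac1x\sum_{n\leq x}f(n,s)f(n+m,\overline{s})=\sum_{q\geq1}\left|\frac{\mu(q)}{q^{s-1}\varphi(q)}\right|^2c_q(m)$$ has the product decomposition $$F(\sigma)=\prod_{p\mid m}\Big(1+\frac{1}{p^{2\sigma-2}(p-1)}\Big)\prod_{p\nmid m}\Big(1-\frac{1}{p^{2\sigma-2}(p-1)^2}\Big).$$ Moreover: (1) if $m$ is odd, then $F(1)=0$ (the limiting value as $\sigma\to1$); (2) if $m\geq2$ is even and $\sigma\geq1$, then $F(\sigma)\geq 1/2$.
   Context: For integers $q\geq1$ and $n$, the Ramanujan sum is $c_q(n)=\sum_{1\leq k\leq q,\ \gcd(k,q)=1}e^{2\pi i kn/q}$; $\mu$ is the Möbius function, $\varphi$ Euler's totient. For $n\geq 1$ and $\Re(s)>1$, $f(n,s)=\sum_{q\geq 1}\frac{\mu(q)}{q^{s-1}\varphi(q)}c_q(n)$. Products over $p$ run over primes. *)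

(* Defs.v *)
From Stdlib Require Import Bool Reals Lra Lia ZArith Arith List Classical ClassicalEpsilon.
Open Scope R_scope.

Definition Cx : Type := (R * R)%type.
Definition Re (z : Cx) : R := fst z.
Definition Im (z : Cx) : R := snd z.
Definition RtoC (r : R) : Cx := (r, 0).
Definition C0 : Cx := (0, 0).
Definition Cadd (z w : Cx) : Cx := (fst z + fst w, snd z + snd w).
Definition Csub (z w : Cx) : Cx := (fst z - fst w, snd z - snd w).
Definition Cmul (z w : Cx) : Cx :=
  (fst z * fst w - snd z * snd w, fst z * snd w + snd z * fst w).
Definition Cnorm2 (z : Cx) : R := fst z * fst z + snd z * snd z.
Definition Cmod (z : Cx) : R := sqrt (Cnorm2 z).
Definition Cinv (z : Cx) : Cx := (fst z / Cnorm2 z, - snd z / Cnorm2 z).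
Definition Cdiv (z w : Cx) : Cx := Cmul z (Cinv w).
Definition Cconj (z : Cx) : Cx := (fst z, - snd z).
Definition Cexp (z : Cx) : Cx := (exp (fst z) * cos (snd z), exp (fst z) * sin (snd z)).
Definition Cpow_nat (q : nat) (z : Cx) : Cx := Cexp (Cmul z (RtoC (ln (INR q)))).

Definition Csum_list (l : list Cx) : Cx := fold_right Cadd C0 l.

Definition is_prime (p : nat) : bool :=
  (2 <=? p)%nat && forallb (fun d => negb (p mod d =? 0)%nat) (seq 2 (p - 2)).

Definition totient (q : nat) : nat :=
  length (filter (fun k => Nat.gcd k q =? 1)%nat (seq 1 q)).

Definition moebius (q : nat) : Z :=
  if existsb (fun p => is_prime p && (q mod (p * p) =? 0)%nat) (seq 1 q) then 0%Z
  else ((-1) ^ Z.of_nat (length (filter (fun p => is_prime p && (q mod p =? 0)%nat)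
                                         (seq 1 q))))%Z.

Definition ramanujan (q n : nat) : Cx :=
  Csum_list (map (fun k => Cexp (0, 2 * PI * INR k * INR n / INR q))
                 (filter (fun k => Nat.gcd k q =? 1)%nat (seq 1 q))).

Definition coef (s : Cx) (q : nat) : Cx :=
  Cdiv (RtoC (IZR (moebius q)))
       (Cmul (Cpow_nat q (Csub s (RtoC 1))) (RtoC (INR (totient q)))).

Definition C_cv (u : nat -> Cx) (l : Cx) : Prop :=
  forall eps, eps > 0 -> exists N, forall n, (n >= N)%nat -> Cmod (Csub (u n) l) < eps.

(** real limit (value chosen by epsilon; meaningful when the sequence converges) *)
Definition lim_R (u : nat -> R) : R := epsilon (inhabits 0) (fun l => Un_cv u l).

Definition Cpsum (a : nat -> Cx) (N : nat) : Cx := Csum_list (map a (seq 1 N)).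

Definition Cseries (a : nat -> Cx) : Cx :=
  (lim_R (fun N => fst (Cpsum a N)), lim_R (fun N => snd (Cpsum a N))).

Definition f (n : nat) (s : Cx) : Cx := Cseries (fun q => Cmul (coef s q) (ramanujan q n)).

Definition avg (m : nat) (s : Cx) (x : R) : Cx :=
  Cmul (RtoC (/ x))
       (Csum_list (map (fun n => Cmul (f n s) (f (n + m) (Cconj s)))
                       (seq 1 (Z.to_nat (Int_part x))))).

Definition Fspec (m : nat) (s : Cx) : Cx :=
  Cseries (fun q => Cmul (RtoC (Cnorm2 (coef s q))) (ramanujan q m)).

Definition euler_factor (m : nat) (sigma : R) (p : nat) : R :=
  if (m mod p =? 0)%nat
  then 1 + / (Rpower (INR p) (2 * sigma - 2) * (INR p - 1))
  else 1 - / (Rpower (INR p) (2 * sigma - 2) * (INR p - 1) ^ 2).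

Definition euler_partial (m : nat) (sigma : R) (N : nat) : R :=
  fold_right Rmult 1 (map (euler_factor m sigma) (filter is_prime (seq 1 N))).

(* Main.v *)
(** Everything is supported on squarefree [q]. For [p] prime and [k] squarefree prime to [p],
    c_{pk}(n) = c_p(n) c_k(n) with c_p(n) = p - 1 or -1 according as [p] divides [n] or not; this
    gives the Euler product, and shows that c_q(n) is real with |c_q(n)| <= gcd(q, n).

    Put delta = (sigma - 1) / 3. Since totient q >> q^(1 - delta), the tail over q > Q of the series
    f(n, s) is O(Q^(-delta) D(n)) with D(n) the sum of d^(-delta) over d | n, and D has bounded mean
    square. So f can be truncated at Q at the cost O(Q^(-delta)) in the average, uniformly in x. For
    the truncated sums the average follows from the orthogonality of the Ramanujan sums: c_q(n)
    c_r(n + m) has mean value c_q(m) if q = r, and 0 otherwise.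

    For odd m the Euler factor at 2 tends to 0 while the others stay bounded; for even m it is at
    least 1, and the others are compared with the product of 1 - 1/k^2 over k >= 2, which is 1/2. *)

From Stdlib Require Import Reals Arith ZArith List.
From Stdlib Require Import Lra Lia Bool Permutation Classical ClassicalEpsilon.
From Coquelicot Require Complex.
Require Import Defs.
Open Scope R_scope.

(** * Complex arithmetic *)

(** The value delta = (sigma - 1) / 3 shares out the excess of sigma over 1: one delta is lost in
    the lower bound for the totient, one is kept as the decay Q^(-delta), and one makes the sum of
    q^(-1-delta) gcd(q, n) converge. The obstacle is uniformity in n: for small delta the function D
    is unbounded, so truncation is affordable only in mean square, with Q fixed before x grows. The
    spectrum behaves better: its coefficients are squared, so one majorant serves all sigma >= 1.
    The Euler product therefore holds at sigma = 1 too, where the bounds for f break down, and (1)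
    and (2) are read off from finite partial products. As [Cseries] selects its value with
    [epsilon], every series must first be shown to converge; this is done through explicit tail
    bounds. *)

Definition C1 : Cx := RtoC 1.
Definition Copp (z : Cx) : Cx := (- fst z, - snd z).

Lemma Cx_eq (z w : Cx) : fst z = fst w -> snd z = snd w -> z = w.
Proof. destruct z, w; simpl; intros; subst; reflexivity. Qed.

Lemma Cx_ring : ring_theory C0 C1 Cadd Cmul Csub Copp eq.
Proof.
  constructor; intros; apply Cx_eq;
    unfold C0, C1, RtoC, Cadd, Cmul, Csub, Copp; simpl; ring.
Qed.
Add Ring Cx_ring_inst : Cx_ring.

Lemma RtoC_mul (x y : R) : RtoC (x * y) = Cmul (RtoC x) (RtoC y).
Proof. apply Cx_eq; simpl; ring. Qed.

Lemma RtoC_add (x y : R) : RtoC (x + y) = Cadd (RtoC x) (RtoC y).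
Proof. apply Cx_eq; simpl; ring. Qed.

Lemma RtoC_sub (x y : R) : RtoC (x - y) = Csub (RtoC x) (RtoC y).
Proof. apply Cx_eq; simpl; ring. Qed.

Lemma Cmod_Coquelicot (z : Cx) : Cmod z = Complex.Cmod z.
Proof. unfold Cmod, Complex.Cmod, Cnorm2. f_equal; ring. Qed.

Lemma Cmod_add (z w : Cx) : Cmod (Cadd z w) <= Cmod z + Cmod w.
Proof. rewrite !Cmod_Coquelicot. apply (Complex.Cmod_triangle z w). Qed.

Lemma Cmod_mul (z w : Cx) : Cmod (Cmul z w) = Cmod z * Cmod w.
Proof. rewrite !Cmod_Coquelicot. apply (Complex.Cmod_mult z w). Qed.

Lemma Cmod_ge0 (z : Cx) : 0 <= Cmod z.
Proof. apply sqrt_pos. Qed.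

Lemma Cmod_RtoC (x : R) : Cmod (RtoC x) = Rabs x.
Proof. rewrite Cmod_Coquelicot. apply (Complex.Cmod_R x). Qed.

Lemma Cmod_opp (z : Cx) : Cmod (Copp z) = Cmod z.
Proof. unfold Cmod, Cnorm2; simpl. f_equal; ring. Qed.

Lemma Cmod_C0 : Cmod C0 = 0.
Proof. change C0 with (RtoC 0). rewrite Cmod_RtoC. apply Rabs_R0. Qed.

Lemma Cmod_sub (z w : Cx) : Cmod (Csub z w) <= Cmod z + Cmod w.
Proof.
  replace (Csub z w) with (Cadd z (Copp w)) by ring.
  rewrite <- (Cmod_opp w). apply Cmod_add.
Qed.

Lemma Cmod_sub_sym (z w : Cx) : Cmod (Csub z w) = Cmod (Csub w z).
Proof. rewrite <- Cmod_opp. f_equal. ring. Qed.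

Lemma Cmod_sub_trans (z w y : Cx) : Cmod (Csub z y) <= Cmod (Csub z w) + Cmod (Csub w y).
Proof.
  replace (Csub z y) with (Cadd (Csub z w) (Csub w y)) by ring. apply Cmod_add.
Qed.

Lemma Cmod_neq0 (z : Cx) : z <> C0 -> 0 < Cmod z.
Proof. rewrite Cmod_Coquelicot. apply (Complex.Cmod_gt_0 z). Qed.

Lemma Rabs_fst_le (z : Cx) : Rabs (fst z) <= Cmod z.
Proof.
  rewrite Cmod_Coquelicot.
  apply Rle_trans with (2 := Complex.Rmax_Cmod z). apply Rmax_l.
Qed.

Lemma Rabs_snd_le (z : Cx) : Rabs (snd z) <= Cmod z.
Proof.
  rewrite Cmod_Coquelicot.
  apply Rle_trans with (2 := Complex.Rmax_Cmod z). apply Rmax_r.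
Qed.

Lemma Cmod_le_abs (z : Cx) : Cmod z <= Rabs (fst z) + Rabs (snd z).
Proof.
  destruct z as [x y]; simpl.
  replace ((x, y) : Cx) with (Cadd (RtoC x) (Cmul (0, 1) (RtoC y)))
    by (apply Cx_eq; simpl; ring).
  eapply Rle_trans; [apply Cmod_add |].
  rewrite Cmod_mul, !Cmod_RtoC.
  replace (Cmod (0, 1)) with 1; [lra |].
  unfold Cmod, Cnorm2; simpl. replace (0 * 0 + 1 * 1) with 1 by ring.
  now rewrite sqrt_1.
Qed.

Lemma Cmod_sqr (z : Cx) : Cmod z * Cmod z = Cnorm2 z.
Proof. apply sqrt_sqrt. unfold Cnorm2. nra. Qed.

(** * Finite sums over lists *)

Definition rsum {A} (l : list A) (g : A -> R) : R := fold_right Rplus 0 (map g l).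
Definition csum {A} (l : list A) (g : A -> Cx) : Cx := Csum_list (map g l).

Section Rsum.
Context {A : Type}.
Implicit Types (l : list A) (g h : A -> R).

Lemma rsum_app l1 l2 g : rsum (l1 ++ l2) g = rsum l1 g + rsum l2 g.
Proof. unfold rsum. induction l1; simpl; [ring |]. rewrite IHl1. ring. Qed.

Lemma rsum_le l g h : (forall x, In x l -> g x <= h x) -> rsum l g <= rsum l h.
Proof.
  unfold rsum. induction l; simpl; intros H; [lra |].
  assert (g a <= h a) by auto.
  assert (fold_right Rplus 0 (map g l) <= fold_right Rplus 0 (map h l)) by auto. lra.
Qed.

Lemma rsum_ext l g h : (forall x, In x l -> g x = h x) -> rsum l g = rsum l h.
Proof. intros H. apply Rle_antisym; apply rsum_le; intros x Hx; rewrite H; auto; lra. Qed.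

Lemma rsum_0 l : rsum l (fun _ => 0) = 0.
Proof. unfold rsum. induction l; simpl; lra. Qed.

Lemma rsum_ge0 l g : (forall x, In x l -> 0 <= g x) -> 0 <= rsum l g.
Proof. intros H. rewrite <- (rsum_0 l). apply rsum_le; auto. Qed.

Lemma rsum_add l g h : rsum l (fun x => g x + h x) = rsum l g + rsum l h.
Proof. unfold rsum. induction l; simpl; [ring |]. rewrite IHl. ring. Qed.

Lemma rsum_scal l c g : rsum l (fun x => c * g x) = c * rsum l g.
Proof. unfold rsum. induction l; simpl; [ring |]. rewrite IHl. ring. Qed.

Lemma rsum_scal_r l c g : rsum l (fun x => g x * c) = rsum l g * c.
Proof. unfold rsum. induction l; simpl; [ring |]. rewrite IHl. ring. Qed.

Lemma rsum_filter (P : A -> bool) l g :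
  rsum (filter P l) g = rsum l (fun x => if P x then g x else 0).
Proof.
  unfold rsum. induction l; simpl; auto.
  destruct (P a); simpl; rewrite IHl; ring.
Qed.

Lemma rsum_perm l1 l2 g : Permutation l1 l2 -> rsum l1 g = rsum l2 g.
Proof. unfold rsum. induction 1; simpl; lra. Qed.

Lemma rsum_in_le l g x : (forall y, In y l -> 0 <= g y) -> In x l -> g x <= rsum l g.
Proof.
  unfold rsum. induction l; simpl; intros Hp Hi; [destruct Hi | destruct Hi as [-> | Hi]].
  - assert (0 <= rsum l g) by (apply rsum_ge0; auto). unfold rsum in *; lra.
  - assert (0 <= g a) by auto.
    assert (g x <= fold_right Rplus 0 (map g l)) by auto. lra.
Qed.

Lemma rsum_incl l1 l2 g : NoDup l1 -> incl l1 l2 -> (forall x, In x l2 -> 0 <= g x) ->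
  rsum l1 g <= rsum l2 g.
Proof.
  revert l2. induction l1 as [|a l1 IH]; intros l2 Hn Hi Hp.
  - apply rsum_ge0; auto.
  - inversion Hn as [| ? ? Ha Hn']; subst.
    assert (In a l2) as Ha2 by (apply Hi; now left).
    destruct (in_split _ _ Ha2) as [u [v ->]].
    rewrite <- (rsum_perm _ _ g (Permutation_middle u v a)).
    assert (rsum l1 g <= rsum (u ++ v) g).
    { apply IH; auto.
      - intros x Hx. assert (In x (u ++ a :: v)) as Hx2 by (apply Hi; now right).
        apply in_app_iff in Hx2. apply in_app_iff. destruct Hx2 as [|[->|]]; tauto.
      - intros x Hx. apply Hp. apply in_app_iff in Hx. apply in_app_iff. simpl. tauto. }
    unfold rsum in *; simpl; lra.
Qed.

End Rsum.

Lemma rsum_mul {A B} (l : list A) (l' : list B) (g : A -> R) (h : B -> R) :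
  rsum l g * rsum l' h = rsum l (fun x => rsum l' (fun y => g x * h y)).
Proof.
  rewrite <- rsum_scal_r. apply rsum_ext; intros x _. now rewrite rsum_scal.
Qed.

Lemma rsum_swap {A B} (l : list A) (l' : list B) (g : A -> B -> R) :
  rsum l (fun x => rsum l' (g x)) = rsum l' (fun y => rsum l (fun x => g x y)).
Proof.
  induction l as [|a l IH].
  - unfold rsum at 1; simpl. unfold rsum; simpl. symmetry. apply rsum_0.
  - change (rsum l' (g a) + rsum l (fun x => rsum l' (g x))
            = rsum l' (fun y => g a y + rsum l (fun x => g x y))).
    rewrite IH. now rewrite rsum_add.
Qed.

Lemma rsum_map {A B} (h : A -> B) l (g : B -> R) : rsum (map h l) g = rsum l (fun x => g (h x)).
Proof. unfold rsum. now rewrite map_map. Qed.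

Section Csum.
Context {A : Type}.
Implicit Types (l : list A) (g h : A -> Cx).

Lemma csum_cons a l g : csum (a :: l) g = Cadd (g a) (csum l g).
Proof. reflexivity. Qed.

Lemma csum_app l1 l2 g : csum (l1 ++ l2) g = Cadd (csum l1 g) (csum l2 g).
Proof.
  induction l1; simpl.
  - unfold csum at 2; simpl. fold C0. ring.
  - rewrite !csum_cons, IHl1. ring.
Qed.

Lemma csum_ext l g h : (forall x, In x l -> g x = h x) -> csum l g = csum l h.
Proof.
  induction l; intros H; [reflexivity |].
  rewrite !csum_cons, IHl, H; auto; simpl; auto.
  intros; apply H; simpl; auto.
Qed.

Lemma csum_0 l : csum l (fun _ => C0) = C0.
Proof. induction l; [reflexivity |]. rewrite csum_cons, IHl. ring. Qed.

Lemma csum_add l g h : csum l (fun x => Cadd (g x) (h x)) = Cadd (csum l g) (csum l h).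
Proof.
  induction l; [apply Cx_eq; simpl; ring |].
  rewrite !csum_cons, IHl. ring.
Qed.

Lemma csum_sub l g h : csum l (fun x => Csub (g x) (h x)) = Csub (csum l g) (csum l h).
Proof.
  induction l; [apply Cx_eq; simpl; ring |].
  rewrite !csum_cons, IHl. ring.
Qed.

Lemma csum_scal l c g : csum l (fun x => Cmul c (g x)) = Cmul c (csum l g).
Proof.
  induction l; [apply Cx_eq; simpl; ring |].
  rewrite !csum_cons, IHl. ring.
Qed.

Lemma csum_scal_r l c g : csum l (fun x => Cmul (g x) c) = Cmul (csum l g) c.
Proof.
  induction l; [apply Cx_eq; simpl; ring |].
  rewrite !csum_cons, IHl. ring.
Qed.

Lemma csum_const l c : csum l (fun _ => c) = Cmul (RtoC (INR (length l))) c.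
Proof.
  induction l; [apply Cx_eq; simpl; ring |].
  rewrite csum_cons, IHl. change (length (a :: l)) with (S (length l)).
  rewrite S_INR, RtoC_add. fold C1. ring.
Qed.

Lemma csum_filter (P : A -> bool) l g :
  csum (filter P l) g = csum l (fun x => if P x then g x else C0).
Proof.
  induction l; simpl; auto.
  rewrite csum_cons. destruct (P a); simpl; rewrite ?csum_cons, IHl; ring.
Qed.

Lemma csum_perm l1 l2 g : Permutation l1 l2 -> csum l1 g = csum l2 g.
Proof.
  induction 1; rewrite ?csum_cons; auto.
  - now rewrite IHPermutation.
  - ring.
  - congruence.
Qed.

Lemma csum_mod l g : Cmod (csum l g) <= rsum l (fun x => Cmod (g x)).
Proof.
  induction l.
  - change (Cmod C0 <= 0). rewrite Cmod_C0; lra.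
  - rewrite csum_cons. eapply Rle_trans; [apply Cmod_add |].
    unfold rsum in *; simpl. lra.
Qed.

End Csum.

Lemma csum_swap {A B} (l : list A) (l' : list B) (g : A -> B -> Cx) :
  csum l (fun x => csum l' (g x)) = csum l' (fun y => csum l (fun x => g x y)).
Proof.
  induction l as [|a l IH].
  - clear; induction l'; [reflexivity |].
    rewrite csum_cons, <- IHl'. apply Cx_eq; simpl; ring.
  - rewrite csum_cons, IH.
    clear; induction l'; [apply Cx_eq; simpl; ring |].
    rewrite !csum_cons, <- IHl'. ring.
Qed.

Lemma csum_mul {A B} (l : list A) (l' : list B) (g : A -> Cx) (h : B -> Cx) :
  Cmul (csum l g) (csum l' h) = csum l (fun x => csum l' (fun y => Cmul (g x) (h y))).
Proof.
  rewrite <- csum_scal_r. apply csum_ext; intros x _.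
  induction l'; [apply Cx_eq; simpl; ring |]. rewrite !csum_cons, <- IHl'. ring.
Qed.

Lemma csum_map {A B} (h : A -> B) l (g : B -> Cx) : csum (map h l) g = csum l (fun x => g (h x)).
Proof. unfold csum. now rewrite map_map. Qed.

Lemma csum_conj {A} (l : list A) g : Cconj (csum l g) = csum l (fun x => Cconj (g x)).
Proof.
  induction l; [apply Cx_eq; simpl; ring |].
  rewrite !csum_cons, <- IHl. apply Cx_eq; simpl; ring.
Qed.

Lemma csum_delta l q (g : nat -> Cx) : NoDup l -> In q l ->
  csum l (fun r => if (q =? r)%nat then g r else C0) = g q.
Proof.
  induction l as [|a l IH]; intros Hn Hi; [destruct Hi |].
  inversion Hn as [| ? ? Ha Hn']; subst.
  rewrite csum_cons. destruct Hi as [-> | Hi].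
  - rewrite Nat.eqb_refl.
    rewrite (csum_ext _ _ (fun _ => C0)), csum_0; [ring |].
    intros x Hx. destruct (Nat.eqb_spec q x); congruence.
  - rewrite IH; auto. destruct (Nat.eqb_spec q a); [congruence | ring].
Qed.

Lemma rsum_seq_S N (g : nat -> R) : rsum (seq 1 (S N)) g = rsum (seq 1 N) g + g (S N).
Proof. rewrite seq_S, rsum_app. f_equal. unfold rsum; simpl. ring. Qed.

(** * Primes and squarefree smooth numbers *)

Definition dvd (d n : nat) : bool := (n mod d =? 0)%nat.

Lemma dvd_iff d n : dvd d n = true <-> Nat.divide d n.
Proof. unfold dvd. rewrite Nat.eqb_eq. apply Nat.Lcm0.mod_divide. Qed.

Lemma is_prime_iff p :
  is_prime p = true <-> (2 <= p)%nat /\ forall d, Nat.divide d p -> d = 1%nat \/ d = p.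
Proof.
  unfold is_prime. rewrite andb_true_iff, Nat.leb_le, forallb_forall.
  split; intros [H2 H]; split; auto.
  - intros d Hd.
    assert (d <> 0)%nat by (intros ->; apply Nat.divide_0_l in Hd; lia).
    assert (d <= p)%nat by (apply Nat.divide_pos_le; auto; lia).
    destruct (Nat.eq_dec d 1); auto. destruct (Nat.eq_dec d p); auto.
    specialize (H d). rewrite in_seq in H. apply dvd_iff in Hd. unfold dvd in Hd.
    rewrite Hd in H. discriminate H. lia.
  - intros d Hd. apply in_seq in Hd. apply negb_true_iff, not_true_iff_false.
    change (dvd d p <> true). rewrite dvd_iff. intros Hd'.
    destruct (H d Hd'); lia.
Qed.

Lemma prime_ge2 p : is_prime p = true -> (2 <= p)%nat.
Proof. intros H. now apply is_prime_iff in H. Qed.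

Lemma prime_gcd p n : is_prime p = true -> ~ Nat.divide p n -> Nat.gcd p n = 1%nat.
Proof.
  intros Hp Hn. apply is_prime_iff in Hp.
  destruct (proj2 Hp (Nat.gcd p n)) as [H | H]; auto.
  - apply Nat.gcd_divide_l.
  - exfalso; apply Hn. rewrite <- H. apply Nat.gcd_divide_r.
Qed.

Lemma gcd1_not_dvd p n : (2 <= p)%nat -> Nat.gcd p n = 1%nat -> ~ Nat.divide p n.
Proof.
  intros Hp Hg Hd.
  assert (Nat.divide p 1) as H1 by (rewrite <- Hg; apply Nat.gcd_greatest; auto using Nat.divide_refl).
  apply Nat.divide_1_r in H1. lia.
Qed.

Lemma prime_divisor n : (2 <= n)%nat -> exists p, is_prime p = true /\ Nat.divide p n.
Proof.
  induction n as [n IH] using lt_wf_ind. intros Hn.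
  destruct (is_prime n) eqn:E; [exists n; split; auto using Nat.divide_refl |].
  unfold is_prime in E. apply andb_false_iff in E. destruct E as [E | E].
  - apply Nat.leb_gt in E. lia.
  - apply not_true_iff_false in E. rewrite forallb_forall in E.
    assert (exists d, (2 <= d < n)%nat /\ Nat.divide d n) as [d [Hd Hdn]].
    { apply NNPP. intros Hno. apply E. intros d Hd. apply in_seq in Hd.
      apply negb_true_iff, not_true_iff_false. change (dvd d n <> true).
      rewrite dvd_iff. intros H. apply Hno. exists d. split; auto. lia. }
    destruct (IH d) as [p [Hp Hpd]]; try lia.
    exists p. split; auto. eapply Nat.divide_trans; eauto.
Qed.

Lemma gcd_mul_1 a b c : Nat.gcd a b = 1%nat -> Nat.gcd a c = 1%nat -> Nat.gcd a (b * c) = 1%nat.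
Proof.
  intros Hb Hc. set (g := Nat.gcd a (b * c)).
  assert (Nat.divide g a) as Hga by apply Nat.gcd_divide_l.
  assert (Nat.divide g (b * c)) as Hgb by apply Nat.gcd_divide_r.
  assert (Nat.gcd g b = 1)%nat as H1.
  { apply Nat.divide_1_r. rewrite <- Hb. apply Nat.gcd_greatest.
    - eapply Nat.divide_trans; [apply Nat.gcd_divide_l | auto].
    - apply Nat.gcd_divide_r. }
  pose proof (Nat.gauss _ _ _ Hgb H1) as Hgc.
  apply Nat.divide_1_r. rewrite <- Hc. now apply Nat.gcd_greatest.
Qed.

Lemma gcd_mul_1_iff a b c :
  Nat.gcd a (b * c) = 1%nat <-> Nat.gcd a b = 1%nat /\ Nat.gcd a c = 1%nat.
Proof.
  split; [| intros []; now apply gcd_mul_1].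
  intros H; split; apply Nat.divide_1_r; rewrite <- H; apply Nat.gcd_greatest;
    auto using Nat.gcd_divide_l.
  - apply Nat.divide_trans with (1 := Nat.gcd_divide_r a b). now apply Nat.divide_factor_l.
  - apply Nat.divide_trans with (1 := Nat.gcd_divide_r a c). now apply Nat.divide_factor_r.
Qed.

(* The squarefree positive integers all of whose prime factors are at most [P]. *)
Fixpoint sqf (P : nat) : list nat :=
  match P with
  | O => 1%nat :: nil
  | S P' => if is_prime P then sqf P' ++ map (Nat.mul P) (sqf P') else sqf P'
  end.

Lemma in_sqf_S P q : In q (sqf (S P)) <->
  In q (sqf P) \/ is_prime (S P) = true /\ exists k, In k (sqf P) /\ q = (S P * k)%nat.
Proof.
  simpl sqf. destruct (is_prime (S P)).
  - rewrite in_app_iff, in_map_iff. split; intros [H | H]; auto.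
    + destruct H as [k [H1 H2]]. right. split; auto. exists k; auto.
    + destruct H as [_ [k [H1 H2]]]. right. exists k; auto.
  - split; auto. intros [H | [H _]]; [auto | discriminate].
Qed.

Lemma sqf_coprime P q p : In q (sqf P) -> is_prime p = true -> (P < p)%nat -> Nat.gcd p q = 1%nat.
Proof.
  revert q. induction P as [|P IH]; intros q Hq Hp HP.
  - destruct Hq as [<- | []]. apply Nat.divide_1_r, Nat.gcd_divide_r.
  - apply in_sqf_S in Hq. destruct Hq as [Hq | [Hpr [k [Hk ->]]]]; [apply IH; auto; lia |].
    apply gcd_mul_1; [| apply IH; auto; lia].
    apply prime_gcd; auto. intros Hd. apply Nat.divide_pos_le in Hd; lia.
Qed.

(** Induction on the largest prime factor: every multiplicative fact below is proved by peeling off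
    a prime p coprime to the rest. *)
Lemma sqf_ind (Q : nat -> Prop) : Q 1%nat ->
  (forall p k P, is_prime p = true -> In k (sqf P) -> Nat.gcd p k = 1%nat -> Q k -> Q (p * k)%nat) ->
  forall P q, In q (sqf P) -> Q q.
Proof.
  intros Q1 QM. induction P as [|P IH]; intros q Hq.
  - destruct Hq as [<- | []]; auto.
  - apply in_sqf_S in Hq. destruct Hq as [Hq | [Hp [k [Hk ->]]]]; auto.
    apply QM with P; auto. apply sqf_coprime with P; auto.
Qed.

Lemma sqf_pos P q : In q (sqf P) -> (1 <= q)%nat.
Proof.
  revert P q. apply sqf_ind; auto. intros p k P Hp _ _ Hk. apply prime_ge2 in Hp. nia.
Qed.

Lemma sqf_NoDup P : NoDup (sqf P).
Proof.
  induction P as [|P IH]; [repeat constructor; auto |].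
  simpl sqf. destruct (is_prime (S P)) eqn:Hp; auto.
  apply NoDup_app; auto.
  - apply FinFun.Injective_map_NoDup; auto. intros x y Hxy. nia.
  - intros q Hq Hq'. apply in_map_iff in Hq'. destruct Hq' as [k [<- Hk]].
    apply (sqf_coprime P _ (S P)) in Hq; auto.
    apply gcd1_not_dvd in Hq; [| now apply prime_ge2].
    apply Hq. exists k. lia.
Qed.

Definition has_square (q : nat) : bool :=
  existsb (fun p => is_prime p && (q mod (p * p) =? 0)%nat) (seq 1 q).

Lemma has_square_iff q : (1 <= q)%nat ->
  has_square q = true <-> exists p, is_prime p = true /\ Nat.divide (p * p) q.
Proof.
  intros Hq. unfold has_square. rewrite existsb_exists. split.
  - intros [p [_ H]]. apply andb_true_iff in H. destruct H as [H1 H2].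
    exists p. split; auto. now apply dvd_iff.
  - intros [p [H1 H2]]. exists p. split.
    + apply in_seq. pose proof (prime_ge2 p H1). apply Nat.divide_pos_le in H2; nia.
    + rewrite H1. simpl. now apply dvd_iff.
Qed.

Lemma sqf_no_square P q p : In q (sqf P) -> is_prime p = true -> ~ Nat.divide (p * p) q.
Proof.
  revert P q. apply (sqf_ind (fun q => is_prime p = true -> ~ Nat.divide (p * p) q)).
  - intros Hp Hd. apply Nat.divide_1_r in Hd. apply prime_ge2 in Hp. nia.
  - intros p' k P Hp' Hk Hg IH Hp Hd.
    pose proof (prime_ge2 _ Hp). pose proof (prime_ge2 _ Hp').
    (* If p = p', cancelling one p from p^2 | p k gives p | k. Otherwise p^2 is coprime to p' and
       must divide k. *)
    destruct (Nat.eq_dec p p') as [<- | Hne].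
    + apply (gcd1_not_dvd p k); auto.
      destruct Hd as [z Hz]. exists z. nia.
    + apply IH; auto. apply Nat.gauss with p'; auto.
      rewrite Nat.gcd_comm. assert (Nat.gcd p' p = 1%nat); [| now apply gcd_mul_1].
      apply prime_gcd; auto. intros Hd'. apply is_prime_iff in Hp.
      destruct (proj2 Hp _ Hd'); lia.
Qed.

(** Descent on P: when [S P] is a prime dividing q, it is divided out, and it cannot divide the
    quotient because q has no square factor. *)
Lemma in_sqf_intro P q : (1 <= q)%nat -> has_square q = false ->
  (forall p, is_prime p = true -> Nat.divide p q -> (p <= P)%nat) -> In q (sqf P).
Proof.
  intros Hq Hs. assert (forall p, is_prime p = true -> ~ Nat.divide (p * p) q) as Hs'.
  { intros p Hp Hd. apply not_true_iff_false in Hs. apply Hs, has_square_iff; eauto. }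
  clear Hs. revert q Hq Hs'. induction P as [|P IH]; intros q Hq Hs HP.
  - destruct (le_lt_dec 2 q) as [H2 | H2]; [| left; lia].
    destruct (prime_divisor q H2) as [p [Hp Hd]].
    specialize (HP p Hp Hd). apply prime_ge2 in Hp. lia.
  - apply in_sqf_S.
    destruct (classic (is_prime (S P) = true /\ Nat.divide (S P) q)) as [[Hp [k Hk]] | Hno].
    + right. split; auto. exists k. split; [| lia].
      apply IH; [lia | |].
      * intros p Hp' Hd. apply (Hs p Hp'). rewrite Hk. now apply Nat.divide_mul_l.
      * intros p Hp' Hd.
        assert (p <= S P)%nat by (apply HP; auto; rewrite Hk; now apply Nat.divide_mul_l).
        destruct (Nat.eq_dec p (S P)) as [-> |]; [| lia].
        exfalso. apply (Hs (S P) Hp). destruct Hd as [z Hz]. exists z. nia.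
    + left. apply IH; auto. intros p Hp Hd. specialize (HP p Hp Hd).
      destruct (Nat.eq_dec p (S P)) as [-> |]; [tauto | lia].
Qed.

(** The sign of the Möbius function disappears from moduli, so the parity of the number of prime
    factors is never computed. *)
Lemma moebius_sqf P q : In q (sqf P) -> IZR (moebius q) * IZR (moebius q) = 1.
Proof.
  intros Hq. unfold moebius. fold (has_square q).
  replace (has_square q) with false.
  - rewrite <- mult_IZR, <- Z.pow_mul_l. change (-1 * -1)%Z with 1%Z.
    now rewrite Z.pow_1_l by lia.
  - symmetry. apply not_true_iff_false. rewrite has_square_iff by (eapply sqf_pos; eauto).
    intros [p [Hp Hd]]. now apply (sqf_no_square P q p).
Qed.

(** The prime factors of q <= P are at most P, so only a square factor can keep q out of [sqf P]. *)
Lemma moebius_not_sqf P q : (1 <= q <= P)%nat -> ~ In q (sqf P) -> moebius q = 0%Z.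
Proof.
  intros Hq Hn. unfold moebius. fold (has_square q).
  destruct (has_square q) eqn:E; auto. exfalso. apply Hn. apply in_sqf_intro; auto; [lia |].
  intros p Hp Hd. apply Nat.divide_pos_le in Hd; lia.
Qed.

(** * Ramanujan sums *)

Definition ee (x : R) : Cx := Cexp (0, 2 * PI * x).

Lemma ee_add x y : ee (x + y) = Cmul (ee x) (ee y).
Proof.
  unfold ee, Cexp; simpl. rewrite exp_0.
  replace (2 * PI * (x + y)) with (2 * PI * x + 2 * PI * y) by ring.
  rewrite cos_plus, sin_plus. apply Cx_eq; simpl; ring.
Qed.

Lemma ee_nat n : ee (INR n) = C1.
Proof.
  unfold ee, Cexp; simpl. rewrite exp_0.
  replace (2 * PI * INR n) with (0 + 2 * INR n * PI) by ring.
  rewrite cos_period, sin_period, cos_0, sin_0. apply Cx_eq; simpl; ring.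
Qed.

Lemma ee_conj x : Cconj (ee x) = ee (- x).
Proof.
  unfold ee, Cexp, Cconj; simpl.
  replace (2 * PI * - x) with (- (2 * PI * x)) by ring.
  rewrite cos_neg, sin_neg. apply Cx_eq; simpl; ring.
Qed.

Lemma Cmod_ee x : Cmod (ee x) = 1.
Proof.
  unfold Cmod, Cnorm2, ee, Cexp; simpl. rewrite exp_0.
  pose proof (sin2_cos2 (2 * PI * x)) as H. unfold Rsqr in H.
  rewrite !Rmult_1_l, Rplus_comm, H. apply sqrt_1.
Qed.

Lemma ee_neq1 x : 0 < Rabs x < 1 -> ee x <> C1.
Proof.
  (* The real part is 1 - 2 sin(pi y)^2, and the sine is positive here. Negative arguments follow by
     conjugation. *)
  assert (forall y, 0 < y < 1 -> ee y <> C1) as Hpos.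
  { intros y Hy H. apply (f_equal fst) in H. unfold ee, Cexp in H; simpl in H.
    rewrite exp_0 in H. replace (2 * PI * y) with (2 * (PI * y)) in H by ring.
    rewrite cos_2a_sin in H. pose proof PI_RGT_0.
    unfold C1, RtoC in H; simpl in H.
    assert (0 < sin (PI * y)) by (apply sin_gt_0; nra). nra. }
  intros Hx H. destruct (Rle_or_lt 0 x) as [H0 | H0].
  - rewrite Rabs_pos_eq in Hx by lra. now apply (Hpos x).
  - rewrite Rabs_left in Hx by lra. apply (Hpos (- x)); [lra |].
    rewrite <- ee_conj, H. apply Cx_eq; simpl; ring.
Qed.

(** Without division the telescoping identity holds for every x. It serves both the vanishing of
    complete sums and the boundedness of incomplete ones. *)
Lemma ee_geometric x a N :
  Cmul (Csub C1 (ee x)) (csum (seq a N) (fun n => ee (INR n * x)))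
  = Csub (ee (INR a * x)) (ee (INR (a + N) * x)).
Proof.
  induction N as [|N IH].
  - rewrite Nat.add_0_r. simpl. change (csum nil (fun n => ee (INR n * x))) with C0. ring.
  - rewrite seq_S, csum_app.
    change (csum ((a + N)%nat :: nil) (fun n => ee (INR n * x)))
      with (Cadd (ee (INR (a + N) * x)) C0).
    replace (INR (a + S N) * x) with (INR (a + N) * x + x)
      by (rewrite Nat.add_succ_r, S_INR; ring).
    rewrite ee_add.
    replace (Cmul (Csub C1 (ee x))
      (Cadd (csum (seq a N) (fun n => ee (INR n * x))) (Cadd (ee (INR (a + N) * x)) C0)))
    with (Cadd (Cmul (Csub C1 (ee x)) (csum (seq a N) (fun n => ee (INR n * x))))
       (Cmul (Csub C1 (ee x)) (ee (INR (a + N) * x)))) by ring.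
    rewrite IH. ring.
Qed.

Lemma Cmul_eq0_r z w : Cmul z w = C0 -> z <> C0 -> w = C0.
Proof.
  intros H Hz. apply NNPP. intros Hw.
  apply Cmod_neq0 in Hz. apply Cmod_neq0 in Hw.
  apply (f_equal Cmod) in H. rewrite Cmod_mul, Cmod_C0 in H. nra.
Qed.

Lemma Csub_neq0 z w : z <> w -> Csub z w <> C0.
Proof.
  intros H H0. apply H. replace z with (Cadd (Csub z w) w) by ring. rewrite H0. ring.
Qed.

Lemma ee_orthogonality p n : (1 <= p)%nat ->
  csum (seq 0 p) (fun t => ee (INR t * INR n / INR p)) = if dvd p n then RtoC (INR p) else C0.
Proof.
  intros Hp. assert (INR p <> 0) by (apply not_0_INR; lia).
  assert (0 < INR p) by (apply lt_0_INR; lia).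
  destruct (dvd p n) eqn:E.
  - apply dvd_iff in E. destruct E as [z ->].
    rewrite (csum_ext _ _ (fun _ => C1)).
    + rewrite csum_const, length_seq. ring.
    + intros t _. replace (INR t * INR (z * p) / INR p) with (INR (t * z)); [apply ee_nat |].
      rewrite !mult_INR. field; auto.
  - rewrite (csum_ext _ _ (fun t => ee (INR t * (INR n / INR p))))
      by (intros; f_equal; unfold Rdiv; ring).
    assert (n mod p <> 0)%nat as Hb by (apply Nat.eqb_neq in E; exact E).
    assert (n mod p < p)%nat by (apply Nat.mod_upper_bound; lia).
    (* The full geometric sum telescopes to 1 - e(n) = 0; it remains to see that the ratio e(n/p) is
       not 1, which is checked on n mod p. *)
    apply Cmul_eq0_r with (Csub C1 (ee (INR n / INR p))).
    + rewrite ee_geometric. simpl INR. rewrite Rmult_0_l.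
      replace (INR p * (INR n / INR p)) with (INR n) by (field; auto).
      rewrite ee_nat. change 0 with (INR 0). rewrite ee_nat. ring.
    + apply Csub_neq0. apply not_eq_sym.
      replace (INR n / INR p) with (INR (n / p) + INR (n mod p) / INR p).
      2: { replace (INR n) with (INR (p * (n / p) + n mod p))
           by (f_equal; symmetry; apply Nat.div_mod_eq).
           rewrite plus_INR, mult_INR. field; auto. }
      rewrite ee_add, ee_nat. replace (Cmul C1 (ee (INR (n mod p) / INR p)))
        with (ee (INR (n mod p) / INR p)) by ring.
      apply ee_neq1.
      assert (0 < INR (n mod p)) by (apply lt_0_INR; lia).
      assert (INR (n mod p) < INR p) by (apply lt_INR; lia).
      rewrite Rabs_pos_eq; [split |].
      * apply Rdiv_lt_0_compat; lra.
      * apply Rmult_lt_reg_r with (INR p); [lra |]. unfold Rdiv.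
        rewrite Rmult_assoc, Rinv_l; lra.
      * apply Rlt_le, Rdiv_lt_0_compat; lra.
Qed.

(** * Multiplicativity of the Ramanujan sums and their bound by gcd(q, n) *)

Definition coprimes (q : nat) : list nat := filter (fun k => Nat.gcd k q =? 1)%nat (seq 1 q).

Lemma ramanujan_ee q n :
  ramanujan q n = csum (coprimes q) (fun k => ee (INR k * INR n / INR q)).
Proof.
  apply csum_ext. intros k _. unfold ee. do 2 f_equal. unfold Rdiv. ring.
Qed.

Lemma ramanujan_0 q : ramanujan q 0 = RtoC (INR (totient q)).
Proof.
  rewrite ramanujan_ee.
  rewrite (csum_ext _ _ (fun _ => C1)).
  - rewrite csum_const. unfold totient, coprimes. ring.
  - intros k _. simpl. unfold Rdiv. rewrite Rmult_0_r, Rmult_0_l.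
    change 0 with (INR 0). apply ee_nat.
Qed.

Lemma ramanujan_1 n : ramanujan 1 n = C1.
Proof.
  rewrite ramanujan_ee. change (coprimes 1) with (1%nat :: nil). rewrite csum_cons.
  replace (INR 1 * INR n / INR 1) with (INR n) by (simpl; field). rewrite ee_nat.
  change (csum nil _) with C0. ring.
Qed.

(** Each residue i modulo k has the p lifts i + k t; with i fixed, the sum over t becomes a complete
    character sum modulo p. *)
Lemma csum_blocks p k (g : nat -> Cx) :
  csum (seq 1 (p * k)) g
  = csum (seq 0 p) (fun t => csum (seq 1 k) (fun i => g (i + k * t)%nat)).
Proof.
  induction p as [|p IH]; [reflexivity |].
  rewrite seq_S, csum_app. simpl plus.
  replace (S p * k)%nat with (p * k + k)%nat by lia.
  rewrite seq_app, csum_app, IH. f_equal.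
  rewrite csum_cons. change (csum nil _) with C0.
  assert (forall a b, seq (a + b) k = map (fun i => i + b)%nat (seq a k)) as Hs.
  { clear. induction k; intros a b; simpl; auto. f_equal. apply (IHk (S a)). }
  rewrite Hs, csum_map.
  rewrite (csum_ext _ (fun x => g (x + p * k)%nat) (fun i => g (i + k * p)%nat)); [ring |].
  intros. do 2 f_equal. ring.
Qed.

Lemma multiples_perm p k : (1 <= p)%nat ->
  Permutation (filter (dvd p) (seq 1 (p * k))) (map (Nat.mul p) (seq 1 k)).
Proof.
  intros Hp. apply NoDup_Permutation.
  - apply NoDup_filter, seq_NoDup.
  - apply FinFun.Injective_map_NoDup; [intros x y; nia | apply seq_NoDup].
  - intros x. rewrite filter_In, in_map_iff, in_seq, dvd_iff. split.
    + intros [Hx [z Hz]]. exists z. rewrite in_seq. split; [lia |]. nia.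
    + intros [z [<- Hz]]. rewrite in_seq in Hz. split; [nia | exists z; lia].
Qed.

Lemma csum_multiples p k (g : nat -> Cx) : (1 <= p)%nat ->
  csum (seq 1 (p * k)) (fun j => if dvd p j then g j else C0)
  = csum (seq 1 k) (fun i => g (p * i)%nat).
Proof.
  intros Hp. rewrite <- csum_filter, (csum_perm _ _ _ (multiples_perm p k Hp)), csum_map.
  reflexivity.
Qed.

Lemma gcd_add_mul i k t : Nat.gcd (i + k * t) k = Nat.gcd i k.
Proof.
  rewrite Nat.gcd_comm, (Nat.mul_comm k t), Nat.gcd_add_mult_diag_r. apply Nat.gcd_comm.
Qed.

(* Among the [j <= p k] coprime to [k], those coprime to [p k] are the ones not divisible
   by [p]. *)
Lemma ramanujan_prime_mul p k n :
  is_prime p = true -> (1 <= k)%nat -> Nat.gcd p k = 1%nat ->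
  ramanujan (p * k) n
  = Csub (if dvd p n then Cmul (RtoC (INR p)) (ramanujan k (n / p)) else C0) (ramanujan k n).
Proof.
  intros Hp Hk Hg. pose proof (prime_ge2 p Hp) as Hp2.
  assert (INR p <> 0) by (apply not_0_INR; lia).
  assert (INR k <> 0) by (apply not_0_INR; lia).
  rewrite !ramanujan_ee. unfold coprimes. rewrite !csum_filter.
  set (h := fun j => if (Nat.gcd j k =? 1)%nat then ee (INR j * INR n / INR (p * k)) else C0).
  rewrite (csum_ext _ _ (fun j => Csub (h j) (if dvd p j then h j else C0))).
  2: { intros j _. unfold h. rewrite (Nat.gcd_comm j (p * k)), (Nat.gcd_comm j k).
       destruct (dvd p j) eqn:Ed.
       - apply dvd_iff in Ed.
         replace (Nat.gcd (p * k) j =? 1)%nat with false; [ring |].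
         symmetry. apply Nat.eqb_neq. rewrite Nat.gcd_comm, gcd_mul_1_iff.
         intros [H1 _]. rewrite Nat.gcd_comm in H1. apply gcd1_not_dvd in H1; auto.
       - assert (Nat.gcd p j = 1%nat) as Hpj.
         { apply prime_gcd; auto. intros Hd. apply dvd_iff in Hd. congruence. }
         rewrite (Nat.gcd_comm (p * k) j), (Nat.gcd_comm k j).
         destruct (Nat.eqb_spec (Nat.gcd j (p * k)) 1) as [H1 | H1];
         destruct (Nat.eqb_spec (Nat.gcd j k) 1) as [H2 | H2]; try ring.
         + apply gcd_mul_1_iff in H1. tauto.
         + exfalso. apply H1. apply gcd_mul_1; auto. now rewrite Nat.gcd_comm. }
  rewrite csum_sub. f_equal.
  - rewrite csum_blocks.
    rewrite (csum_ext _ _ (fun t => csum (seq 1 k) (fun i => Cmul (h i) (ee (INR t * INR n / INR p))))).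
    (* Coprimality to k depends on i only, and the exponential at i + k t splits as (i + k t) n / (p
       k) = i n / (p k) + t n / p. *)
    2: { intros t _. apply csum_ext. intros i _. unfold h. rewrite gcd_add_mul.
         destruct (Nat.gcd i k =? 1)%nat; [| ring].
         rewrite <- ee_add. f_equal. rewrite plus_INR, !mult_INR. field. auto. }
    rewrite csum_swap.
    rewrite (csum_ext _ _ (fun i => Cmul (h i) (if dvd p n then RtoC (INR p) else C0))).
    2: { intros i _. rewrite csum_scal, ee_orthogonality by lia. reflexivity. }
    rewrite csum_scal_r. destruct (dvd p n) eqn:Ed; [| ring].
    apply dvd_iff in Ed. destruct Ed as [z ->]. rewrite Nat.div_mul by lia.
    replace (csum (seq 1 k) h) with
      (csum (seq 1 k) (fun x => if (Nat.gcd x k =? 1)%nat then ee (INR x * INR z / INR k) else C0));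
      [ring |].
    apply csum_ext. intros i _. unfold h. destruct (Nat.gcd i k =? 1)%nat; auto.
    f_equal. rewrite !mult_INR. field. auto.
  (* For j = p i the factor p cancels in the exponent, and p being coprime to k leaves the
     coprimality condition on i unchanged. *)
  - rewrite csum_multiples by lia. apply csum_ext. intros i _. unfold h.
    replace (Nat.gcd (p * i) k =? 1)%nat with (Nat.gcd i k =? 1)%nat.
    + destruct (Nat.gcd i k =? 1)%nat; auto. f_equal. rewrite !mult_INR. field. auto.
    + rewrite (Nat.gcd_comm (p * i)), (Nat.gcd_comm i).
      destruct (Nat.eqb_spec (Nat.gcd k i) 1) as [H1 | H1];
      destruct (Nat.eqb_spec (Nat.gcd k (p * i)) 1) as [H2 | H2]; auto; exfalso.
      * apply H2, gcd_mul_1; auto. now rewrite Nat.gcd_comm.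
      * apply gcd_mul_1_iff in H2. tauto.
Qed.

Lemma dvd_mul_coprime p u n : Nat.gcd p u = 1%nat -> dvd p (u * n) = dvd p n.
Proof.
  intros Hg. apply eq_true_iff_eq. rewrite !dvd_iff. split; intros H.
  - now apply Nat.gauss with u.
  - now apply Nat.divide_mul_r.
Qed.

(** This removes the argument [n / p] from [ramanujan_prime_mul]: n = p (n / p) with p coprime to k.
    It is proved from that same recursion instead of by permuting residues. *)
Lemma ramanujan_coprime_mul P q u n :
  In q (sqf P) -> Nat.gcd u q = 1%nat -> ramanujan q (u * n) = ramanujan q n.
Proof.
  intros Hq. revert P q Hq n.
  apply (sqf_ind (fun q => forall n, Nat.gcd u q = 1%nat -> ramanujan q (u * n) = ramanujan q n)).
  - intros. now rewrite !ramanujan_1.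
  - intros p k P Hp Hk Hpk IH n Hu. pose proof (prime_ge2 p Hp).
    apply gcd_mul_1_iff in Hu. destruct Hu as [Hu1 Hu2].
    rewrite !ramanujan_prime_mul by (auto; eapply sqf_pos; eauto).
    rewrite dvd_mul_coprime by (now rewrite Nat.gcd_comm). rewrite (IH n) by auto.
    destruct (dvd p n) eqn:Ed; auto.
    apply dvd_iff in Ed. destruct Ed as [z ->].
    rewrite Nat.mul_assoc, !Nat.div_mul by lia. now rewrite IH.
Qed.

(** For p | n the recursion gives p c_k(n/p) - c_k(n), and c_k(n/p) = c_k(n) since p is coprime to
    k. *)
Lemma ramanujan_sqf_mul P p k n :
  is_prime p = true -> In k (sqf P) -> Nat.gcd p k = 1%nat ->
  ramanujan (p * k) n = Cmul (RtoC (if dvd p n then INR p - 1 else - 1)) (ramanujan k n).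
Proof.
  intros Hp Hk Hg. pose proof (prime_ge2 p Hp).
  rewrite ramanujan_prime_mul by (auto; eapply sqf_pos; eauto).
  destruct (dvd p n) eqn:Ed.
  - apply dvd_iff in Ed. destruct Ed as [z ->]. rewrite Nat.div_mul by lia.
    rewrite (Nat.mul_comm z p), (ramanujan_coprime_mul P k p z) by auto.
    rewrite RtoC_sub. fold C1. ring.
  - apply Cx_eq; simpl; ring.
Qed.

(** The totient of q is c_q(0), and every prime divides 0. *)
Lemma totient_sqf_mul P p k :
  is_prime p = true -> In k (sqf P) -> Nat.gcd p k = 1%nat ->
  INR (totient (p * k)) = (INR p - 1) * INR (totient k).
Proof.
  intros Hp Hk Hg. pose proof (prime_ge2 p Hp).
  pose proof (ramanujan_sqf_mul P p k 0 Hp Hk Hg) as Hr.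
  rewrite !ramanujan_0 in Hr.
  replace (dvd p 0) with true in Hr by (symmetry; apply dvd_iff, Nat.divide_0_r).
  rewrite <- RtoC_mul in Hr. now apply (f_equal fst) in Hr.
Qed.

Lemma totient_1 : INR (totient 1) = 1.
Proof. reflexivity. Qed.

Lemma totient_pos q : (1 <= q)%nat -> 0 < INR (totient q).
Proof.
  intros Hq. apply lt_0_INR. unfold totient.
  assert (In 1%nat (filter (fun k => Nat.gcd k q =? 1)%nat (seq 1 q))) as H1.
  { apply filter_In. rewrite in_seq. split; [lia |]. now apply Nat.eqb_eq. }
  destruct (filter _ _); simpl in *; [tauto | lia].
Qed.

Lemma ramanujan_real P q n : In q (sqf P) -> snd (ramanujan q n) = 0.
Proof.
  revert P q. apply (sqf_ind (fun q => snd (ramanujan q n) = 0)).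
  - now rewrite ramanujan_1.
  - intros p k P Hp Hk Hg IH. rewrite (ramanujan_sqf_mul P) by auto. simpl. rewrite IH. ring.
Qed.

Lemma ramanujan_le_gcd P q n : (1 <= n)%nat -> In q (sqf P) ->
  Cmod (ramanujan q n) <= INR (Nat.gcd q n).
Proof.
  intros Hn. revert P q. apply (sqf_ind (fun q => Cmod (ramanujan q n) <= INR (Nat.gcd q n))).
  - rewrite ramanujan_1. unfold C1. rewrite Cmod_RtoC, Rabs_R1. simpl. lra.
  - intros p k P Hp Hk Hg IH. pose proof (prime_ge2 p Hp) as Hp2.
    rewrite (ramanujan_sqf_mul P) by auto.
    rewrite Cmod_mul, Cmod_RtoC. pose proof (Cmod_ge0 (ramanujan k n)).
    assert (2 <= INR p) by (apply (le_INR 2); auto).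
    assert (Nat.gcd (p * k) n <> 0)%nat
      by (intros Hz; apply Nat.gcd_eq_0 in Hz; lia).
    pose proof (Nat.gcd_divide_l k n). pose proof (Nat.gcd_divide_r k n).
    destruct (dvd p n) eqn:Ed.
    + rewrite Rabs_pos_eq by lra. apply dvd_iff in Ed.
      (* The factor p - 1 is weakened to p, because p gcd(k, n) divides gcd(p k, n): gcd(k, n) is
         coprime to p, so it still divides n / p. *)
      apply Rle_trans with (INR (p * Nat.gcd k n)).
      * rewrite mult_INR. nra.
      * apply le_INR, Nat.divide_pos_le; [lia |]. apply Nat.gcd_greatest.
        -- now apply Nat.mul_divide_mono_l.
        -- destruct Ed as [z Hz].
           assert (Nat.divide (Nat.gcd k n) z) as [w Hw].
           { apply Nat.gauss with p.
             - rewrite Nat.mul_comm, <- Hz. auto.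
             - apply Nat.divide_1_r. rewrite <- Hg. apply Nat.gcd_greatest.
               + apply Nat.gcd_divide_r.
               + eapply Nat.divide_trans; [apply Nat.gcd_divide_l | auto]. }
           exists w. rewrite Hz, Hw at 1. ring.
    + rewrite Rabs_left by lra. replace (- -1) with 1 by lra.
      rewrite Rmult_1_l. apply Rle_trans with (1 := IH).
      apply le_INR, Nat.divide_pos_le; [lia |]. apply Nat.gcd_greatest; auto.
      now apply Nat.divide_mul_r.
Qed.

(** * Powers and convergent majorants *)

Definition pw (q : nat) (a : R) : R := Rpower (INR q) a.

Lemma pw_pos q a : 0 < pw q a.
Proof. apply exp_pos. Qed.

Lemma pw_add q a b : pw q (a + b) = pw q a * pw q b.
Proof. apply Rpower_plus. Qed.

Lemma pw_mul q r a : (1 <= q)%nat -> (1 <= r)%nat -> pw (q * r) a = pw q a * pw r a.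
Proof.
  intros. unfold pw. rewrite mult_INR. symmetry. apply Rpower_mult_distr; apply lt_0_INR; lia.
Qed.

Lemma pw_0 q : pw q 0 = 1.
Proof. unfold pw, Rpower. now rewrite Rmult_0_l, exp_0. Qed.

Lemma pw_one a : pw 1 a = 1.
Proof. unfold pw, Rpower. simpl. now rewrite ln_1, Rmult_0_r, exp_0. Qed.

Lemma pw_1 q : (1 <= q)%nat -> pw q 1 = INR q.
Proof. intros. apply Rpower_1, lt_0_INR. lia. Qed.

Lemma pw_le q a b : (1 <= q)%nat -> a <= b -> pw q a <= pw q b.
Proof. intros Hq. apply Rle_Rpower. now apply (le_INR 1). Qed.

Lemma pw_ge1 q a : (1 <= q)%nat -> 0 <= a -> 1 <= pw q a.
Proof. intros. rewrite <- (pw_0 q). now apply pw_le. Qed.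

Lemma pw_opp q a : pw q (- a) * pw q a = 1.
Proof. rewrite <- pw_add, Rplus_opp_l. apply pw_0. Qed.

Lemma pw_mono q r a : (1 <= q <= r)%nat -> 0 <= a -> pw q a <= pw r a.
Proof.
  intros. apply Rle_Rpower_l; auto. split; [apply lt_0_INR; lia | apply le_INR; lia].
Qed.

Lemma pw_anti q r a : (1 <= q <= r)%nat -> 0 <= a -> pw r (- a) <= pw q (- a).
Proof.
  intros H Ha. pose proof (pw_mono q r a H Ha).
  pose proof (pw_opp q a). pose proof (pw_opp r a).
  pose proof (pw_pos q a). pose proof (pw_pos r a).
  pose proof (pw_pos q (- a)). pose proof (pw_pos r (- a)). nra.
Qed.

Lemma pw_unbounded a M : 0 < a -> exists N, (1 <= N)%nat /\ forall n, (N <= n)%nat -> M <= pw n a.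
Proof.
  (* The maximum with 1 gives [Rpower] a positive base when M is not positive. *)
  intros Ha. destruct (INR_unbounded (Rpower (Rmax M 1) (/ a))) as [N HN].
  assert (0 < Rmax M 1) by (apply Rlt_le_trans with 1; [lra | apply Rmax_r]).
  exists (S N). split; [lia |]. intros n Hn.
  apply Rle_trans with (Rmax M 1); [apply Rmax_l |].
  replace (Rmax M 1) with (Rpower (Rpower (Rmax M 1) (/ a)) a).
  - apply Rle_Rpower_l; [lra |]. split; [apply exp_pos |].
    apply Rle_trans with (INR N); [lra | apply le_INR; lia].
  - rewrite Rpower_mult, Rinv_l, Rpower_1; lra.
Qed.

Lemma pw_vanish a c eps : 0 < a -> 0 <= c -> 0 < eps ->
  exists N, (1 <= N)%nat /\ forall n, (N <= n)%nat -> c * pw n (- a) < eps.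
Proof.
  (* The summand 1 makes the final inequality strict. *)
  intros Ha Hc He. destruct (pw_unbounded a (c / eps + 1) Ha) as [N [HN1 HN]].
  exists N. split; auto. intros n Hn. specialize (HN n Hn).
  pose proof (pw_opp n a). pose proof (pw_pos n (- a)).
  assert (c * pw n (- a) + eps * pw n (- a) <= eps); [| nra].
  replace eps with (eps * (pw n (- a) * pw n a)) at 2 by (rewrite H; ring).
  apply Rle_trans with (eps * (pw n (- a) * (c / eps + 1))).
  - right. field. lra.
  - apply Rmult_le_compat_l; [lra |]. apply Rmult_le_compat_l; lra.
Qed.

(* The ratio [q^(1-e) / totient q] is multiplicative on squarefree [q], and its value at a prime
   [p] is at most 2, and at most 1 once [p^e >= 2]. *)
Lemma totient_lower_bound e : 0 < e ->
  exists C, 0 < C /\ forall P q, In q (sqf P) -> pw q (1 - e) <= C * INR (totient q).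
Proof.
  intros He. destruct (pw_unbounded e 2 He) as [P0 [_ HP0]].
  assert (forall n, 1 <= 2 ^ n) as H2 by (intros; apply pow_R1_Rle; lra).
  exists (2 ^ P0). split; [apply Rlt_le_trans with 1; auto; lra |].
  (* One factor 2 is allowed for every integer up to [P0], prime or not; beyond [P0] the constant no
     longer grows. *)
  assert (forall P q, In q (sqf P) -> pw q (1 - e) <= 2 ^ (min P P0) * INR (totient q)) as H.
  { induction P as [|P IH]; intros q Hq.
    - destruct Hq as [<- | []]. rewrite pw_one, totient_1. simpl. lra.
    - apply in_sqf_S in Hq.
      assert (2 ^ min P P0 <= 2 ^ min (S P) P0) by (apply Rle_pow; [lra | lia]).
      destruct Hq as [Hq | [Hp [k [Hk ->]]]].
      + apply Rle_trans with (1 := IH q Hq). apply Rmult_le_compat_r; auto. apply pos_INR.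
      + assert (Nat.gcd (S P) k = 1%nat) as Hg by (apply (sqf_coprime P); auto).
        rewrite (totient_sqf_mul P), pw_mul by (auto; try lia; eapply sqf_pos; eauto).
        specialize (IH k Hk).
        assert (2 <= INR (S P)) by (apply (le_INR 2), prime_ge2; auto).
        pose proof (pw_pos (S P) (1 - e)). pose proof (pw_pos k (1 - e)).
        assert (0 < INR (totient k)) by (eapply totient_pos, sqf_pos; eauto).
        destruct (le_lt_dec (S P) P0) as [Hle | Hlt].
        * assert (pw (S P) (1 - e) <= 2 * (INR (S P) - 1)).
          { apply Rle_trans with (pw (S P) 1); [apply pw_le; [lia | lra] |].
            rewrite pw_1 by lia. lra. }
          replace (min (S P) P0) with (S (min P P0)) by lia.
          change (2 ^ S (min P P0)) with (2 * 2 ^ min P P0).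
          replace (2 * 2 ^ min P P0 * ((INR (S P) - 1) * INR (totient k)))
            with (2 * (INR (S P) - 1) * (2 ^ min P P0 * INR (totient k))) by ring.
          apply Rmult_le_compat; lra.
        (* As p^e >= 2, the left side is at most p / 2, which is at most p - 1. *)
        * assert (pw (S P) (1 - e) <= INR (S P) - 1).
          { assert (pw (S P) (1 - e) * pw (S P) e = INR (S P)).
            { rewrite <- pw_add. replace (1 - e + e) with 1 by ring. apply pw_1; lia. }
            specialize (HP0 (S P)). assert (2 <= pw (S P) e) by (apply HP0; lia). nra. }
          replace (min (S P) P0) with (min P P0) by lia.
          replace (2 ^ min P P0 * ((INR (S P) - 1) * INR (totient k)))
            with ((INR (S P) - 1) * (2 ^ min P P0 * INR (totient k))) by ring.
          apply Rmult_le_compat; lra. }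
  intros P q Hq. apply Rle_trans with (1 := H P q Hq).
  apply Rmult_le_compat_r; [apply pos_INR |]. apply Rle_pow; [lra | lia].
Qed.

(** This is 1 + x <= exp x at x = -1/(K+1), after taking logarithms. *)
Lemma ln_succ_lower K : (1 <= K)%nat -> / INR (S K) <= ln (INR (S K)) - ln (INR K).
Proof.
  intros HK. assert (0 < INR K) by (apply lt_0_INR; lia).
  assert (0 < INR (S K)) by (apply lt_0_INR; lia).
  assert (INR K / INR (S K) <= exp (- / INR (S K))) as H1.
  { replace (INR K / INR (S K)) with (1 + - / INR (S K)); [apply exp_ineq1_le |].
    rewrite S_INR in *. field. lra. }
  assert (ln (INR K / INR (S K)) <= - / INR (S K)) as H2.
  { apply Rnot_lt_le. intros Hlt. apply exp_increasing in Hlt.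
    rewrite exp_ln in Hlt by (now apply Rdiv_lt_0_compat). lra. }
  unfold Rdiv in H2. rewrite ln_mult, ln_Rinv in H2; auto; [lra |]. now apply Rinv_0_lt_compat.
Qed.

Lemma zeta_bound d K : 0 < d -> rsum (seq 1 K) (fun k => pw k (- 1 - d)) <= 1 + / d.
Proof.
  intros Hd. assert (0 < / d) by now apply Rinv_0_lt_compat.
  (* The integral comparison in telescoping form: q^(-1-d) <= ((q-1)^(-d) - q^(-d)) / d. The
     subtracted term is what lets the induction close. *)
  assert (forall K, rsum (seq 1 (S K)) (fun k => pw k (- 1 - d))
          <= 1 + / d - / d * pw (S K) (- d)) as H0.
  { clear K. induction K as [|K IH].
    - unfold rsum; simpl. rewrite !pw_one. lra.
    - rewrite rsum_seq_S.
      assert (pw (S (S K)) (- 1 - d) <= / d * (pw (S K) (- d) - pw (S (S K)) (- d))); [| lra].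
      set (q := S (S K)).
      assert (pw q (- 1 - d) = / INR q * pw q (- d)) as ->.
      { replace (- 1 - d) with (- 1 + - d) by ring. rewrite pw_add. f_equal.
        assert (pw q (- 1) * INR q = 1) by (rewrite <- (pw_1 q) by (unfold q; lia); apply pw_opp).
        assert (INR q <> 0) by (apply not_0_INR; unfold q; lia).
        apply Rmult_eq_reg_r with (INR q); auto. rewrite Rinv_l; auto. }
      assert (pw (S K) (- d) = pw q (- d) * exp (d * (ln (INR q) - ln (INR (S K))))) as ->.
      { unfold pw, Rpower. rewrite <- exp_plus. f_equal. ring. }
      pose proof (pw_pos q (- d)).
      (* After division by q^(-d): 1/q is at most L = ln q - ln(q-1), and d L <= exp(d L) - 1. *)
      assert (/ INR q <= / d * (exp (d * (ln (INR q) - ln (INR (S K)))) - 1)); [| nra].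
      apply Rle_trans with (ln (INR q) - ln (INR (S K))); [apply ln_succ_lower; lia |].
      pose proof (exp_ineq1_le (d * (ln (INR q) - ln (INR (S K))))).
      apply Rmult_le_reg_l with d; [lra |].
      rewrite <- Rmult_assoc, Rinv_r; lra. }
  destruct K as [|K]; [unfold rsum; simpl; lra |].
  specialize (H0 K). pose proof (pw_pos (S K) (- d)). nra.
Qed.

(** * Series with an explicit tail bound *)

Lemma Un_cv_lim_R (U : nat -> R) l : Un_cv U l -> Un_cv U (lim_R U).
Proof. intros H. unfold lim_R. apply epsilon_spec. now exists l. Qed.

(** The Cauchy bound yields convergence, so the value chosen by [epsilon] is the limit; the bound
    then passes to it by comparison at a far index. *)
Lemma lim_R_tail (U : nat -> R) eta T : 0 < eta -> 0 <= T ->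
  (forall Q K, (1 <= Q <= K)%nat -> Rabs (U K - U Q) <= T * pw Q (- eta)) ->
  Un_cv U (lim_R U) /\
  forall Q, (1 <= Q)%nat -> Rabs (U Q - lim_R U) <= T * pw Q (- eta).
Proof.
  intros He HT HU. assert (Un_cv U (lim_R U)) as Hcv.
  { assert (Cauchy_crit U) as Hc.
    { intros eps Heps. destruct (pw_vanish eta T (eps / 2) He HT ltac:(lra)) as [N [HN1 HN]].
      exists N. intros n m Hn Hm. unfold Rdist.
      pose proof (HU N n ltac:(lia)). pose proof (HU N m ltac:(lia)).
      specialize (HN N (le_n N)).
      replace (U n - U m) with ((U n - U N) - (U m - U N)) by ring.
      eapply Rle_lt_trans; [apply Rabs_triang |]. rewrite Rabs_Ropp. lra. }
    destruct (R_complete U Hc) as [l Hl]. now apply Un_cv_lim_R with l. }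
  split; auto. intros Q HQ. apply le_epsilon. intros eps Heps.
  destruct (Hcv eps Heps) as [N HN]. specialize (HN (max N Q) ltac:(lia)).
  unfold Rdist in HN. pose proof (HU Q (max N Q) ltac:(lia)) as H1.
  rewrite Rabs_minus_sym in H1.
  replace (U Q - lim_R U) with ((U Q - U (max N Q)) + (U (max N Q) - lim_R U)) by ring.
  eapply Rle_trans; [apply Rabs_triang |]. lra.
Qed.

(** Rankin's trick: if the terms stay summable after multiplication by q^eta, the tail beyond Q is
    at most T Q^(-eta). *)
Section Majorant.
Context (u : nat -> Cx) (v : nat -> R) (eta T : R) (eta_pos : 0 < eta)
  (u_le : forall q, (1 <= q)%nat -> Cmod (u q) * pw q eta <= v q)
  (v_sum : forall K, rsum (seq 1 K) v <= T).

Lemma majorant_ge0 q : (1 <= q)%nat -> 0 <= v q.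
Proof.
  intros Hq. eapply Rle_trans; [| apply u_le; auto].
  apply Rmult_le_pos; [apply Cmod_ge0 | apply Rlt_le, pw_pos].
Qed.

Lemma majorant_bound_ge0 : 0 <= T.
Proof. apply Rle_trans with (2 := v_sum 0). unfold rsum; simpl; lra. Qed.

Lemma term_le Q q : (1 <= Q <= q)%nat -> Cmod (u q) <= pw Q (- eta) * v q.
Proof.
  intros HQ. pose proof (pw_opp q eta). pose proof (pw_pos q (- eta)).
  apply Rle_trans with (pw q (- eta) * v q).
  - replace (Cmod (u q)) with (pw q (- eta) * (Cmod (u q) * pw q eta)).
    + apply Rmult_le_compat_l; [lra |]. apply u_le. lia.
    + rewrite (Rmult_comm (Cmod (u q))), <- Rmult_assoc, H. ring.
  - apply Rmult_le_compat_r; [apply majorant_ge0; lia |]. apply pw_anti; [lia | lra].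
Qed.

Lemma Cpsum_sub Q K : (1 <= Q <= K)%nat ->
  Cmod (Csub (Cpsum u K) (Cpsum u Q)) <= T * pw Q (- eta).
Proof.
  intros HQ. change (Cpsum u K) with (csum (seq 1 K) u). change (Cpsum u Q) with (csum (seq 1 Q) u).
  replace K with (Q + (K - Q))%nat at 1 by lia. rewrite seq_app, csum_app.
  replace (Csub (Cadd (csum (seq 1 Q) u) (csum (seq (1 + Q) (K - Q)) u)) (csum (seq 1 Q) u))
    with (csum (seq (1 + Q) (K - Q)) u) by ring.
  eapply Rle_trans; [apply csum_mod |].
  apply Rle_trans with (rsum (seq (1 + Q) (K - Q)) (fun q => pw Q (- eta) * v q)).
  - apply rsum_le. intros q Hq. apply in_seq in Hq. apply term_le. lia.
  - rewrite rsum_scal, Rmult_comm. apply Rmult_le_compat_r; [apply Rlt_le, pw_pos |].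
    apply Rle_trans with (2 := v_sum K). apply rsum_incl.
    + apply seq_NoDup.
    + intros q Hq. apply in_seq in Hq. apply in_seq. lia.
    + intros q Hq. apply in_seq in Hq. apply majorant_ge0. lia.
Qed.

Lemma Cpsum_le Q : Cmod (Cpsum u Q) <= T.
Proof.
  eapply Rle_trans; [apply csum_mod |]. apply Rle_trans with (2 := v_sum Q).
  apply rsum_le. intros q Hq. apply in_seq in Hq.
  replace (v q) with (pw 1 (- eta) * v q) by (rewrite pw_one; ring). apply term_le. lia.
Qed.

Lemma Cseries_tail Q : (1 <= Q)%nat ->
  Cmod (Csub (Cpsum u Q) (Cseries u)) <= 2 * T * pw Q (- eta).
Proof.
  intros HQ. eapply Rle_trans; [apply Cmod_le_abs |]. simpl.
  (* [Cseries] takes the limits of the real and imaginary parts separately; each contributes T,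
     whence the factor 2. *)
  assert (forall Q K, (1 <= Q <= K)%nat ->
    Rabs (fst (Cpsum u K) - fst (Cpsum u Q)) <= T * pw Q (- eta)) as H1.
  { intros Q' K HQ'. eapply Rle_trans; [| apply (Cpsum_sub Q' K HQ')].
    apply (Rabs_fst_le (Csub (Cpsum u K) (Cpsum u Q'))). }
  assert (forall Q K, (1 <= Q <= K)%nat ->
    Rabs (snd (Cpsum u K) - snd (Cpsum u Q)) <= T * pw Q (- eta)) as H2.
  { intros Q' K HQ'. eapply Rle_trans; [| apply (Cpsum_sub Q' K HQ')].
    apply (Rabs_snd_le (Csub (Cpsum u K) (Cpsum u Q'))). }
  pose proof (proj2 (lim_R_tail _ eta T eta_pos majorant_bound_ge0 H1) Q HQ).
  pose proof (proj2 (lim_R_tail _ eta T eta_pos majorant_bound_ge0 H2) Q HQ). lra.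
Qed.

Lemma Cseries_le : Cmod (Cseries u) <= 3 * T.
Proof.
  pose proof (Cseries_tail 1 (le_n 1)) as H. rewrite pw_one in H.
  pose proof (Cpsum_le 1).
  replace (Cseries u) with (Csub (Cpsum u 1) (Csub (Cpsum u 1) (Cseries u))) by ring.
  eapply Rle_trans; [apply Cmod_sub |]. lra.
Qed.
End Majorant.

(** * Divisor sums *)

Definition dv (d n : nat) : R := if dvd d n then 1 else 0.

Lemma dv_01 d n : 0 <= dv d n <= 1.
Proof. unfold dv. destruct (dvd d n); lra. Qed.

(** The single term d = gcd(a, b) suffices. The crude bound is used because its summands separate a
    from b. *)
Lemma gcd_le_divisor_sum a b M : (1 <= a)%nat -> (a <= M \/ 1 <= b <= M)%nat ->
  INR (Nat.gcd a b) <= rsum (seq 1 M) (fun d => dv d a * dv d b * INR d).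
Proof.
  intros Ha HM.
  assert (Nat.gcd a b <> 0)%nat by (intros Hz; apply Nat.gcd_eq_0 in Hz; lia).
  assert (Nat.gcd a b <= M)%nat.
  { destruct HM as [HM | [Hb HM]]; (eapply Nat.le_trans; [| exact HM]);
      apply Nat.divide_pos_le; auto using Nat.gcd_divide_l, Nat.gcd_divide_r. }
  apply Rle_trans with (dv (Nat.gcd a b) a * dv (Nat.gcd a b) b * INR (Nat.gcd a b)).
  - unfold dv. rewrite (proj2 (dvd_iff _ a)), (proj2 (dvd_iff _ b))
      by auto using Nat.gcd_divide_l, Nat.gcd_divide_r. lra.
  - apply (rsum_in_le (seq 1 M) (fun d => dv d a * dv d b * INR d)).
    + intros d _. pose proof (dv_01 d a). pose proof (dv_01 d b).
      repeat apply Rmult_le_pos; try tauto. apply pos_INR.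
    + apply in_seq. lia.
Qed.

(** Writing q = d k factors out d^(-1-del) and leaves a partial zeta sum. *)
Lemma zeta_multiples_bound del d K : 0 < del -> (1 <= d)%nat ->
  rsum (seq 1 K) (fun q => dv d q * pw q (- 1 - del)) <= pw d (- 1 - del) * (1 + / del).
Proof.
  intros Hdel Hd.
  rewrite (rsum_ext _ _ (fun q => if dvd d q then pw q (- 1 - del) else 0))
    by (intros; unfold dv; destruct (dvd d x); ring).
  rewrite <- rsum_filter.
  apply Rle_trans with (rsum (map (Nat.mul d) (seq 1 K)) (fun q => pw q (- 1 - del))).
  - apply rsum_incl.
    + apply NoDup_filter, seq_NoDup.
    + intros q Hq. apply filter_In in Hq. destruct Hq as [Hq Hdq].
      apply in_seq in Hq. apply dvd_iff in Hdq. destruct Hdq as [z ->].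
      apply in_map_iff. exists z. split; [lia |]. apply in_seq. nia.
    + intros. apply Rlt_le, pw_pos.
  - rewrite rsum_map.
    rewrite (rsum_ext _ _ (fun k => pw d (- 1 - del) * pw k (- 1 - del)))
      by (intros k Hk; apply in_seq in Hk; apply pw_mul; lia).
    rewrite rsum_scal. apply Rmult_le_compat_l; [apply Rlt_le, pw_pos | now apply zeta_bound].
Qed.

(** The common multiples of d and e are the multiples of L = lcm(d, e), at most N / L of them, and L
    gcd(d, e) = d e. *)
Lemma common_multiples_count d e N : (1 <= d)%nat -> (1 <= e)%nat ->
  rsum (seq 1 N) (fun n => dv d n * dv e n) * (INR d * INR e) <= INR N * INR (Nat.gcd d e).
Proof.
  intros Hd He. set (L := Nat.lcm d e).
  assert (L * Nat.gcd d e = d * e)%nat as HL.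
  { unfold L, Nat.lcm. destruct (Nat.gcd_divide_r d e) as [z Hz].
    assert (Nat.gcd d e <> 0)%nat by (intros H; apply Nat.gcd_eq_0 in H; lia).
    set (g := Nat.gcd d e) in *. clearbody g. rewrite Hz, Nat.div_mul by auto. ring. }
  assert (L <> 0)%nat by nia.
  assert (rsum (seq 1 N) (fun n => dv d n * dv e n) = INR (length (filter (dvd L) (seq 1 N)))) as ->.
  { assert (forall l, rsum l (fun _ : nat => 1) = INR (length l)) as Hc.
    { induction l as [|a l IH]; [reflexivity |].
      change (1 + rsum l (fun _ => 1) = INR (S (length l))). rewrite S_INR, IH. ring. }
    rewrite <- Hc, rsum_filter. apply rsum_ext. intros n _. unfold dv.
    assert (dvd L n = dvd d n && dvd e n) as ->.
    { apply eq_true_iff_eq. rewrite andb_true_iff, !dvd_iff. apply Nat.lcm_divide_iff. }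
    destruct (dvd d n), (dvd e n); simpl; ring. }
  rewrite <- !mult_INR, <- HL. apply le_INR.
  rewrite Nat.mul_assoc. apply Nat.mul_le_mono_r.
  apply Nat.le_trans with (N / L * L)%nat; [| rewrite Nat.mul_comm; now apply Nat.Div0.mul_div_le].
  apply Nat.mul_le_mono_r.
  replace (N / L)%nat with (length (map (Nat.mul L) (seq 1 (N / L))))
    by now rewrite length_map, length_seq.
  apply NoDup_incl_length; [apply NoDup_filter, seq_NoDup |].
  intros n Hn. apply filter_In in Hn. destruct Hn as [Hn Hdn].
  apply in_seq in Hn. apply dvd_iff in Hdn. destruct Hdn as [z ->].
  apply in_map_iff. exists z. split; [lia |]. apply in_seq.
  split; [nia |]. apply Nat.lt_succ_r. apply Nat.div_le_lower_bound; lia.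
Qed.

(** The divisor function sigma_{-del}(n), called D in the overview. *)
Definition sigma_neg (del : R) (n : nat) : R := rsum (seq 1 n) (fun d => dv d n * pw d (- del)).

Lemma sigma_neg_ge0 del n : 0 <= sigma_neg del n.
Proof.
  apply rsum_ge0. intros d _. apply Rmult_le_pos; [apply dv_01 | apply Rlt_le, pw_pos].
Qed.

(** Expand the gcd over the divisors d of n and sum over the multiples q of d first: what remains is
    d d^(-1-del) = d^(-del). *)
Lemma gcd_series_bound del n K : 0 < del -> (1 <= n)%nat ->
  rsum (seq 1 K) (fun q => pw q (- 1 - del) * INR (Nat.gcd q n)) <= (1 + / del) * sigma_neg del n.
Proof.
  intros Hdel Hn.
  apply Rle_trans with (rsum (seq 1 K) (fun q => rsum (seq 1 n) (fun d =>
     (dv d n * INR d) * (dv d q * pw q (- 1 - del))))).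
  - apply rsum_le. intros q Hq. apply in_seq in Hq.
    apply Rle_trans with (pw q (- 1 - del) * rsum (seq 1 n) (fun d => dv d q * dv d n * INR d)).
    + apply Rmult_le_compat_l; [apply Rlt_le, pw_pos |].
      apply gcd_le_divisor_sum; lia.
    + rewrite <- rsum_scal. apply rsum_le. intros. right. ring.
  - rewrite rsum_swap. unfold sigma_neg. rewrite <- rsum_scal.
    apply rsum_le. intros d Hd. apply in_seq in Hd. rewrite rsum_scal.
    apply Rle_trans with (dv d n * INR d * (pw d (- 1 - del) * (1 + / del))).
    + apply Rmult_le_compat_l; [apply Rmult_le_pos; [apply dv_01 | apply pos_INR] |].
      apply zeta_multiples_bound; auto; lia.
    + right. replace (pw d (- del)) with (INR d * pw d (- 1 - del)); [ring |].
      rewrite <- (pw_1 d) by lia. rewrite <- pw_add. f_equal. ring.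
Qed.

Lemma sigma_neg_mean_square del N : 0 < del ->
  rsum (seq 1 N) (fun n => sigma_neg del n * sigma_neg del n) <= (1 + / del) ^ 3 * INR N.
Proof.
  intros Hdel. set (Z := 1 + / del). set (z := fun d => pw d (- 1 - del)).
  assert (0 < Z) by (unfold Z; pose proof (Rinv_0_lt_compat del Hdel); lra).
  assert (forall d, (1 <= d)%nat -> pw d (- del) = INR d * z d) as Hz.
  { intros d Hd. unfold z. rewrite <- (pw_1 d) by lia. rewrite <- pw_add. f_equal. ring. }
  assert (forall d, 0 < z d) as Hz0 by (intros; apply pw_pos).
  set (S := seq 1 N).
  (* Letting d and e run up to N instead of n makes their range independent of n, so that the sums
     can be exchanged. *)
  apply Rle_trans with (rsum S (fun n => rsum S (fun d => rsum S (fun e =>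
     (dv d n * pw d (- del)) * (dv e n * pw e (- del)))))).
  { apply rsum_le. intros n Hn. apply in_seq in Hn.
    rewrite <- (rsum_mul S S (fun d => dv d n * pw d (- del)) (fun d => dv d n * pw d (- del))).
    pose proof (sigma_neg_ge0 del n).
    assert (sigma_neg del n <= rsum S (fun d => dv d n * pw d (- del))).
    { apply rsum_incl; [apply seq_NoDup | |].
      - intros d Hd. apply in_seq in Hd. apply in_seq. lia.
      - intros d _. apply Rmult_le_pos; [apply dv_01 | apply Rlt_le, pw_pos]. }
    apply Rmult_le_compat; auto. }
  rewrite rsum_swap.
  (* Counting n gives at most N gcd(d, e) / (d e); the gcd is then expanded over common divisors g
     to decouple d from e. *)
  apply Rle_trans with (rsum S (fun d => rsum S (fun e => rsum S (fun g =>
     INR N * INR g * ((dv g d * z d) * (dv g e * z e)))))).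
  { apply rsum_le. intros d Hd. apply in_seq in Hd.
    rewrite rsum_swap. apply rsum_le. intros e He. apply in_seq in He.
    rewrite (rsum_ext _ _ (fun n => (dv d n * dv e n) * ((INR d * INR e) * (z d * z e))))
      by (intros n _; rewrite (Hz d), (Hz e) by lia; ring).
    rewrite rsum_scal_r, <- Rmult_assoc.
    rewrite (rsum_ext S (fun g => INR N * INR g * ((dv g d * z d) * (dv g e * z e)))
      (fun g => (z d * z e) * INR N * (dv g d * dv g e * INR g))) by (intros; ring).
    rewrite rsum_scal, (Rmult_assoc (z d * z e)), (Rmult_comm _ (z d * z e)).
    apply Rmult_le_compat_l; [apply Rlt_le, Rmult_lt_0_compat; auto |].
    eapply Rle_trans; [apply common_multiples_count; lia |].
    apply Rmult_le_compat_l; [apply pos_INR |]. apply gcd_le_divisor_sum; lia. }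
  rewrite (rsum_ext _ _ (fun d => rsum S (fun g => rsum S (fun e =>
     INR N * INR g * ((dv g d * z d) * (dv g e * z e))))))
    by (intros; apply rsum_swap).
  rewrite rsum_swap.
  (* The sums over d and e give [z g * Z] each. One [z g] absorbs the factor g, as g z(g) = g^(-del)
     <= 1; the other is summed and supplies the third Z. *)
  apply Rle_trans with (rsum S (fun g => (INR N * (Z * Z)) * z g)).
  - apply rsum_le. intros g Hg. apply in_seq in Hg.
    set (W := rsum S (fun d => dv g d * z d)).
    assert (W <= z g * Z) as HW by (apply zeta_multiples_bound; auto; lia).
    assert (0 <= W).
    { apply rsum_ge0. intros. apply Rmult_le_pos; [apply dv_01 | apply Rlt_le; auto]. }
    apply Rle_trans with (INR N * INR g * (W * W)).
    + unfold W. rewrite rsum_mul. rewrite <- rsum_scal. apply rsum_le. intros d _.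
      rewrite <- rsum_scal. lra.
    + assert (W * W <= (z g * Z) * (z g * Z)) by (apply Rmult_le_compat; auto).
      assert (INR g * z g <= 1).
      { rewrite <- Hz by lia. rewrite <- (pw_0 g). apply pw_le; [lia | lra]. }
      apply Rle_trans with (INR N * INR g * ((z g * Z) * (z g * Z))).
      * apply Rmult_le_compat_l; auto. apply Rmult_le_pos; apply pos_INR.
      * replace (INR N * INR g * (z g * Z * (z g * Z)))
          with (INR N * (Z * Z) * z g * (INR g * z g)) by ring.
        rewrite <- (Rmult_1_r (INR N * (Z * Z) * z g)) at 2.
        apply Rmult_le_compat_l; auto.
        pose proof (pos_INR N). specialize (Hz0 g). repeat apply Rmult_le_pos; lra.
  - rewrite rsum_scal. replace (Z ^ 3 * INR N) with (INR N * (Z * Z) * Z) by ring.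
    apply Rmult_le_compat_l.
    + pose proof (pos_INR N). repeat apply Rmult_le_pos; lra.
    + now apply zeta_bound.
Qed.

(** * Mean values *)

(* The mean value is reached with error O(1/N). *)
Definition has_mean (g : nat -> Cx) (mu : Cx) : Prop :=
  exists B, forall N, Cmod (Csub (csum (seq 1 N) g) (Cmul (RtoC (INR N)) mu)) <= B.

Lemma has_mean_ext g h mu : (forall n, g n = h n) -> has_mean g mu -> has_mean h mu.
Proof.
  intros H [B HB]. exists B. intros N. rewrite <- (csum_ext _ g h); auto.
Qed.

Lemma has_mean_const c : has_mean (fun _ => c) c.
Proof.
  exists 0. intros N. rewrite csum_const, length_seq.
  replace (Csub _ _) with C0 by ring. rewrite Cmod_C0. lra.
Qed.

Lemma has_mean_add g h a b : has_mean g a -> has_mean h b ->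
  has_mean (fun n => Cadd (g n) (h n)) (Cadd a b).
Proof.
  intros [A HA] [B HB]. exists (A + B). intros N. specialize (HA N). specialize (HB N).
  rewrite csum_add.
  replace (Csub _ _) with
    (Cadd (Csub (csum (seq 1 N) g) (Cmul (RtoC (INR N)) a))
          (Csub (csum (seq 1 N) h) (Cmul (RtoC (INR N)) b))) by ring.
  eapply Rle_trans; [apply Cmod_add |]. lra.
Qed.

Lemma has_mean_scal c g a : has_mean g a -> has_mean (fun n => Cmul c (g n)) (Cmul c a).
Proof.
  intros [A HA]. exists (Cmod c * A). intros N. specialize (HA N).
  rewrite csum_scal.
  replace (Csub _ _) with (Cmul c (Csub (csum (seq 1 N) g) (Cmul (RtoC (INR N)) a))) by ring.
  rewrite Cmod_mul. apply Rmult_le_compat_l; auto. apply Cmod_ge0.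
Qed.

Lemma has_mean_csum {A} (l : list A) (g : A -> nat -> Cx) (mu : A -> Cx) :
  (forall i, In i l -> has_mean (g i) (mu i)) ->
  has_mean (fun n => csum l (fun i => g i n)) (csum l mu).
Proof.
  induction l as [|a l IH]; intros H.
  - apply (has_mean_const C0).
  - apply (has_mean_add (g a) (fun n => csum l (fun i => g i n))); auto using in_eq.
    apply IH. intros i Hi. apply H. now right.
Qed.

Lemma has_mean_ee x : 0 < Rabs x < 1 -> has_mean (fun n => ee (INR n * x)) C0.
Proof.
  intros Hx. assert (Csub C1 (ee x) <> C0) as Hne
    by (apply Csub_neq0, not_eq_sym, ee_neq1; auto).
  apply Cmod_neq0 in Hne. exists (2 / Cmod (Csub C1 (ee x))). intros N.
  replace (Csub _ _) with (csum (seq 1 N) (fun n => ee (INR n * x))) by ring.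
  apply Rmult_le_reg_l with (Cmod (Csub C1 (ee x))); auto.
  rewrite <- Cmod_mul, ee_geometric.
  eapply Rle_trans; [apply Cmod_sub |]. rewrite !Cmod_ee. right. field. lra.
Qed.

Lemma coprime_fraction_unique q r k l :
  (1 <= q)%nat -> (1 <= r)%nat -> Nat.gcd k q = 1%nat -> Nat.gcd l r = 1%nat ->
  (k * r = l * q)%nat -> q = r /\ k = l.
Proof.
  intros Hq Hr Hk Hl H.
  assert (q = r) as <-.
  { apply Nat.divide_antisym.
    - apply Nat.gauss with k; [exists l; lia | now rewrite Nat.gcd_comm].
    - apply Nat.gauss with l; [exists k; lia | now rewrite Nat.gcd_comm]. }
  split; auto. nia.
Qed.

(* Conjugating the real number [c_q(n)] turns the exponents [k/q + l/r] into differences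
   [l/r - k/q] in (-1, 1), which are integers only when [k/q = l/r]. *)
Lemma ramanujan_correlation P q r m : In q (sqf P) -> In r (sqf P) ->
  has_mean (fun n => Cmul (ramanujan q n) (ramanujan r (n + m)))
           (if (q =? r)%nat then ramanujan r m else C0).
Proof.
  intros Hq Hr. pose proof (sqf_pos P q Hq) as Hq1. pose proof (sqf_pos P r Hr) as Hr1.
  assert (0 < INR q) by (apply lt_0_INR; lia).
  assert (0 < INR r) by (apply lt_0_INR; lia).
  set (term := fun k l n => Cmul (ee (INR l * INR m / INR r))
                 (ee (INR n * (INR l / INR r - INR k / INR q)))).
  apply has_mean_ext with
    (fun n => csum (coprimes q) (fun k => csum (coprimes r) (fun l => term k l n))).
  { intros n.
    replace (ramanujan q n) with (Cconj (ramanujan q n))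
      by (apply Cx_eq; simpl; rewrite ?(ramanujan_real P q n Hq); ring).
    rewrite !ramanujan_ee, csum_conj, csum_mul.
    apply csum_ext. intros k _. apply csum_ext. intros l _. unfold term.
    rewrite ee_conj, <- !ee_add. f_equal. rewrite plus_INR. field. lra. }
  assert (forall q k, In k (coprimes q) -> (1 <= k <= q)%nat /\ Nat.gcd k q = 1%nat) as Hcop.
  { intros q' k Hk. apply filter_In in Hk. rewrite in_seq in Hk. rewrite Nat.eqb_eq in Hk.
    split; [lia | tauto]. }
  assert (forall k l, In k (coprimes q) -> In l (coprimes r) -> (q = r -> k <> l) ->
    has_mean (term k l) C0) as Hterm.
  { intros k l Hk Hl Hne. apply Hcop in Hk. apply Hcop in Hl.
    replace C0 with (Cmul (ee (INR l * INR m / INR r)) C0) by ring.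
    apply has_mean_scal. apply has_mean_ee.
    assert (INR k <= INR q) by (apply le_INR; lia).
    assert (INR l <= INR r) by (apply le_INR; lia).
    assert (0 < INR k) by (apply lt_0_INR; lia).
    assert (0 < INR l) by (apply lt_0_INR; lia).
    assert (0 < INR l / INR r <= 1).
    { split; [now apply Rdiv_lt_0_compat |].
      apply Rmult_le_reg_r with (INR r); auto. unfold Rdiv. rewrite Rmult_assoc, Rinv_l; lra. }
    assert (0 < INR k / INR q <= 1).
    { split; [now apply Rdiv_lt_0_compat |].
      apply Rmult_le_reg_r with (INR q); auto. unfold Rdiv. rewrite Rmult_assoc, Rinv_l; lra. }
    split; [| apply Rabs_def1; lra].
    apply Rabs_pos_lt. intros Heq.
    destruct (coprime_fraction_unique q r k l) as [Eq1 Eq2]; try tauto.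
    apply INR_eq. rewrite !mult_INR.
    assert (INR l / INR r * (INR q * INR r) = INR k / INR q * (INR q * INR r)) as Eq3 by (f_equal; lra).
    replace (INR l / INR r * (INR q * INR r)) with (INR l * INR q) in Eq3 by (field; lra).
    replace (INR k / INR q * (INR q * INR r)) with (INR k * INR r) in Eq3 by (field; lra). lra. }
  destruct (Nat.eqb_spec q r) as [<- | Hqr].
  - rewrite ramanujan_ee. apply has_mean_csum. intros k Hk.
    (* For q = r exactly the pair l = k has a nonzero mean, so the target is spread over l with a
       Kronecker delta and matched pair by pair. *)
    replace (ee (INR k * INR m / INR q)) with
      (csum (coprimes q) (fun l => if (k =? l)%nat then ee (INR l * INR m / INR q) else C0)).
    + apply has_mean_csum. intros l Hl. destruct (Nat.eqb_spec k l) as [<- | Hkl]; auto.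
      apply has_mean_ext with (fun _ => ee (INR k * INR m / INR q)); [| apply has_mean_const].
      intros n. unfold term. replace (INR n * (INR k / INR q - INR k / INR q)) with (INR 0)
        by (simpl; ring). rewrite ee_nat. ring.
    + rewrite csum_delta; auto. apply NoDup_filter, seq_NoDup.
  - replace C0 with (csum (coprimes q) (fun _ => csum (coprimes r) (fun _ => C0)))
      by (rewrite (csum_ext _ _ (fun _ => C0)); intros; apply csum_0).
    apply has_mean_csum. intros k Hk. apply has_mean_csum. intros l Hl.
    apply Hterm; auto.
Qed.

(** * The coefficients *)

Lemma Cmul_inv_l w : w <> C0 -> Cmul (Cinv w) w = C1.
Proof.
  intros Hw. apply Cmod_neq0 in Hw.
  assert (Cnorm2 w <> 0) as H by (rewrite <- Cmod_sqr; nra).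
  unfold Cnorm2 in H. apply Cx_eq; unfold Cinv, Cnorm2; simpl; field; auto.
Qed.

Lemma Cmod_div z w : 0 < Cmod w -> Cmod (Cdiv z w) = Cmod z / Cmod w.
Proof.
  intros Hw. assert (w <> C0) as Hw0 by (intros ->; rewrite Cmod_C0 in Hw; lra).
  unfold Cdiv. rewrite Cmod_mul. unfold Rdiv. f_equal.
  apply Rmult_eq_reg_r with (Cmod w); [| lra].
  rewrite <- Cmod_mul, Cmul_inv_l, Rinv_l by (auto; lra).
  unfold C1. rewrite Cmod_RtoC. apply Rabs_R1.
Qed.

Lemma Cmod_pow_nat q z : Cmod (Cpow_nat q z) = pw q (Re z).
Proof.
  unfold Cpow_nat, Cexp, Cmod, Cnorm2; simpl.
  rewrite Rmult_0_r, Rminus_0_r.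
  set (t := fst z * ln (INR q)). set (y := fst z * 0 + snd z * ln (INR q)).
  replace (_ + _) with (exp t * exp t * (Rsqr (sin y) + Rsqr (cos y))) by (unfold Rsqr; ring).
  rewrite sin2_cos2, Rmult_1_r. apply sqrt_square. apply Rlt_le, exp_pos.
Qed.

Lemma Cmod_coef P q s : In q (sqf P) ->
  Cmod (coef s q) = / (pw q (Re s - 1) * INR (totient q)).
Proof.
  intros Hq. pose proof (totient_pos q (sqf_pos P q Hq)) as Ht.
  assert (Cmod (Cmul (Cpow_nat q (Csub s (RtoC 1))) (RtoC (INR (totient q))))
          = pw q (Re s - 1) * INR (totient q)) as Hden.
  { rewrite Cmod_mul, Cmod_pow_nat, Cmod_RtoC, Rabs_pos_eq by lra. reflexivity. }
  unfold coef. rewrite Cmod_div; rewrite Hden.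
  - rewrite Cmod_RtoC.
    replace (Rabs (IZR (moebius q))) with 1; [unfold Rdiv; ring |].
    pose proof (moebius_sqf P q Hq) as Hm.
    unfold Rabs. destruct (Rcase_abs (IZR (moebius q))); nra.
  - apply Rmult_lt_0_compat; auto. apply pw_pos.
Qed.

Lemma coef_not_sqf P q s : (1 <= q <= P)%nat -> ~ In q (sqf P) -> coef s q = C0.
Proof.
  intros Hq Hn. unfold coef. rewrite (moebius_not_sqf P) by auto.
  unfold Cdiv. change (RtoC 0) with C0. ring.
Qed.

Lemma Cconj_mul z w : Cconj (Cmul z w) = Cmul (Cconj z) (Cconj w).
Proof. apply Cx_eq; simpl; ring. Qed.

Lemma Cconj_inv w : Cconj (Cinv w) = Cinv (Cconj w).
Proof.
  unfold Cinv. replace (Cnorm2 (Cconj w)) with (Cnorm2 w) by (unfold Cnorm2; simpl; ring).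
  apply Cx_eq; simpl; unfold Rdiv; ring.
Qed.

Lemma Cconj_RtoC x : Cconj (RtoC x) = RtoC x.
Proof. apply Cx_eq; simpl; ring. Qed.

Lemma Cconj_exp z : Cconj (Cexp z) = Cexp (Cconj z).
Proof. unfold Cexp; simpl. rewrite cos_neg, sin_neg. apply Cx_eq; simpl; ring. Qed.

Lemma coef_conj s q : coef (Cconj s) q = Cconj (coef s q).
Proof.
  unfold coef, Cdiv, Cpow_nat.
  rewrite Cconj_mul, Cconj_inv, !Cconj_mul, Cconj_exp, Cconj_mul, !Cconj_RtoC.
  replace (Cconj (Csub s (RtoC 1))) with (Csub (Cconj s) (RtoC 1)) by (apply Cx_eq; simpl; ring).
  reflexivity.
Qed.

(** The constant comes before s: it must serve s and its conjugate together, and all sigma >= 1 at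
    once in the spectrum. *)
Lemma coef_bound e : 0 < e -> exists C, 0 < C /\
  forall s q, (1 <= q)%nat -> Cmod (coef s q) <= C * pw q (e - Re s).
Proof.
  intros He. destruct (totient_lower_bound e He) as [C [HC H]].
  exists C. split; auto. intros s q Hq.
  destruct (in_dec Nat.eq_dec q (sqf q)) as [Hi | Hi].
  - rewrite (Cmod_coef q) by auto. specialize (H q q Hi).
    pose proof (totient_pos q Hq). pose proof (pw_pos q (Re s - 1)).
    assert (0 < pw q (Re s - 1) * INR (totient q)) by (apply Rmult_lt_0_compat; auto).
    apply Rmult_le_reg_r with (pw q (Re s - 1) * INR (totient q)); auto.
    rewrite Rinv_l by lra.
    apply Rle_trans with (pw q (e - Re s) * pw q (Re s - 1) * pw q (1 - e)).
    + rewrite <- !pw_add. right. symmetry.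
      replace (e - Re s + (Re s - 1) + (1 - e)) with 0 by ring. apply pw_0.
    + replace (C * pw q (e - Re s) * (pw q (Re s - 1) * INR (totient q)))
        with (pw q (e - Re s) * pw q (Re s - 1) * (C * INR (totient q))) by ring.
      apply Rmult_le_compat_l; auto. apply Rmult_le_pos; apply Rlt_le, pw_pos.
  - rewrite (coef_not_sqf q) by (auto; lia). rewrite Cmod_C0.
    apply Rmult_le_pos; apply Rlt_le; auto. apply pw_pos.
Qed.

Lemma coef_ramanujan_le s q n : (1 <= q)%nat -> (1 <= n)%nat ->
  Cmod (coef s q) * Cmod (ramanujan q n) <= Cmod (coef s q) * INR (Nat.gcd q n).
Proof.
  intros Hq Hn. destruct (in_dec Nat.eq_dec q (sqf q)) as [Hi | Hi].
  - apply Rmult_le_compat_l; [apply Cmod_ge0 |]. now apply (ramanujan_le_gcd q).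
  - rewrite (coef_not_sqf q) by (auto; lia). rewrite Cmod_C0. lra.
Qed.

Definition f_term (s : Cx) (n q : nat) : Cx := Cmul (coef s q) (ramanujan q n).

Lemma f_approx del : 0 < del -> exists A, 0 < A /\
  forall s n, Re s = 1 + 3 * del -> (1 <= n)%nat ->
    Cmod (f n s) <= A * sigma_neg del n /\
    forall Q, (1 <= Q)%nat ->
      Cmod (Cpsum (f_term s n) Q) <= A * sigma_neg del n /\
      Cmod (Csub (Cpsum (f_term s n) Q) (f n s)) <= A * sigma_neg del n * pw Q (- del).
Proof.
  intros Hdel. destruct (coef_bound del Hdel) as [C [HC Hcoef]].
  pose proof (Rinv_0_lt_compat del Hdel).
  set (A := C * (1 + / del)). assert (0 < A) by (unfold A; apply Rmult_lt_0_compat; lra).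
  exists (3 * A). split; [lra |]. intros s n Hs Hn.
  pose proof (sigma_neg_ge0 del n) as Hsig.
  (* The coefficients are O(q^(-1-2 del)); the weight q^del spends one more del and leaves
     q^(-1-del). *)
  set (v := fun q => C * (pw q (- 1 - del) * INR (Nat.gcd q n))).
  assert (forall q, (1 <= q)%nat -> Cmod (f_term s n q) * pw q del <= v q) as Hv.
  { intros q Hq. unfold f_term. rewrite Cmod_mul.
    pose proof (coef_ramanujan_le s q n Hq Hn). pose proof (pw_pos q del).
    apply Rle_trans with (Cmod (coef s q) * INR (Nat.gcd q n) * pw q del);
      [apply Rmult_le_compat_r; lra |].
    apply Rle_trans with (C * pw q (del - Re s) * INR (Nat.gcd q n) * pw q del).
    - apply Rmult_le_compat_r; [lra |]. apply Rmult_le_compat_r; [apply pos_INR | auto].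
    - right. unfold v. replace (- 1 - del) with (del - Re s + del) by lra.
      rewrite pw_add. ring. }
  assert (forall K, rsum (seq 1 K) v <= A * sigma_neg del n) as Hsum.
  { intros K. unfold v. rewrite rsum_scal. unfold A. rewrite Rmult_assoc.
    apply Rmult_le_compat_l; [lra |]. now apply gcd_series_bound. }
  assert (0 <= A * sigma_neg del n) by (apply Rmult_le_pos; lra).
  split.
  - pose proof (Cseries_le _ v del _ Hdel Hv Hsum) as H2.
    change (Cseries (f_term s n)) with (f n s) in H2. lra.
  - intros Q HQ. split.
    + pose proof (Cpsum_le _ v del _ Hdel Hv Hsum Q). lra.
    + pose proof (Cseries_tail _ v del _ Hdel Hv Hsum Q HQ) as H2.
      change (Cseries (f_term s n)) with (f n s) in H2.
      pose proof (pw_pos Q (- del)).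
      apply Rle_trans with (1 := H2). apply Rmult_le_compat_r; lra.
Qed.

Definition spec_term (m : nat) (s : Cx) (q : nat) : Cx :=
  Cmul (RtoC (Cnorm2 (coef s q))) (ramanujan q m).

(** A totient loss of q^(1/4) bounds the squared coefficient by O(q^(-3/2)) for every sigma >= 1.
    The Ramanujan sum is at most m, and the weight q^(1/4) still leaves the summable q^(-5/4). *)
Lemma spec_majorant m : (1 <= m)%nat -> exists v T,
  (forall K, rsum (seq 1 K) v <= T) /\
  forall s, 1 <= Re s -> forall q, (1 <= q)%nat ->
    Cmod (spec_term m s q) * pw q (1 / 4) <= v q.
Proof.
  intros Hm. destruct (coef_bound (1 / 4) ltac:(lra)) as [C [HC Hcoef]].
  exists (fun q => C * C * INR m * pw q (- 1 - 1 / 4)), (C * C * INR m * (1 + / (1 / 4))).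
  assert (0 <= C * C * INR m) by (apply Rmult_le_pos; [nra | apply pos_INR]).
  split.
  - intros K. rewrite rsum_scal. apply Rmult_le_compat_l; auto. apply zeta_bound. lra.
  - intros s Hs q Hq. unfold spec_term.
    rewrite Cmod_mul, Cmod_RtoC, <- Cmod_sqr, Rabs_pos_eq by (apply Rle_0_sqr).
    pose proof (Cmod_ge0 (coef s q)) as H0.
    assert (Cmod (coef s q) <= C * pw q (1 / 4 - 1)) as H1.
    { apply Rle_trans with (1 := Hcoef s q Hq). apply Rmult_le_compat_l; [lra |].
      apply pw_le; auto. lra. }
    pose proof (coef_ramanujan_le s q m Hq Hm) as H2.
    assert (INR (Nat.gcd q m) <= INR m) as H3.
    { apply le_INR, Nat.divide_pos_le; [lia | apply Nat.gcd_divide_r]. }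
    assert (Cmod (coef s q) * Cmod (ramanujan q m) <= C * pw q (1 / 4 - 1) * INR m) as H4.
    { apply Rle_trans with (1 := H2). apply Rmult_le_compat; auto. apply pos_INR. }
    pose proof (pw_pos q (1 / 4)) as H5.
    apply Rle_trans with ((C * pw q (1 / 4 - 1)) * (C * pw q (1 / 4 - 1) * INR m) * pw q (1 / 4)).
    + apply Rmult_le_compat_r; [lra |]. rewrite Rmult_assoc.
      apply Rmult_le_compat; auto. apply Rmult_le_pos; apply Cmod_ge0.
    + right. replace (- 1 - 1 / 4) with ((1 / 4 - 1) + (1 / 4 - 1) + 1 / 4) by field.
      rewrite !pw_add. ring.
Qed.

Lemma spec_term_not_sqf m s P q : (1 <= q <= P)%nat -> ~ In q (sqf P) -> spec_term m s q = C0.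
Proof.
  intros Hq Hn. unfold spec_term. rewrite (coef_not_sqf P) by auto.
  apply Cx_eq; simpl; unfold Cnorm2; simpl; ring.
Qed.

(** * The mean value of [f n s * f (n + m) (conj s)] *)

Lemma truncated_mean m s Q :
  has_mean (fun n => Cmul (Cpsum (f_term s n) Q) (Cpsum (f_term (Cconj s) (n + m)) Q))
           (Cpsum (spec_term m s) Q).
Proof.
  set (S := seq 1 Q).
  apply has_mean_ext with (fun n => csum S (fun q => csum S (fun r =>
    Cmul (f_term s n q) (f_term (Cconj s) (n + m) r)))).
  { intros n. symmetry. apply (csum_mul S S). }
  replace (Cpsum (spec_term m s) Q) with
    (csum S (fun q => csum S (fun r => if (q =? r)%nat then spec_term m s r else C0))).
  2: { apply csum_ext. intros q Hq. apply csum_delta; auto. apply seq_NoDup. }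
  apply has_mean_csum. intros q Hq. apply has_mean_csum. intros r Hr.
  apply in_seq in Hq. apply in_seq in Hr. unfold f_term.
  assert (forall g, (forall n, g n = C0) -> has_mean g C0) as Hzero.
  { intros g Hg. apply has_mean_ext with (fun _ => C0); auto. apply has_mean_const. }
  (* The correlation of Ramanujan sums is available for squarefree indices; for the others the
     coefficient vanishes. *)
  destruct (in_dec Nat.eq_dec q (sqf Q)) as [Hiq | Hiq].
  2: { replace (if (q =? r)%nat then spec_term m s r else C0) with C0.
       - apply Hzero. intros n. rewrite (coef_not_sqf Q q) by (auto; lia). ring.
       - destruct (Nat.eqb_spec q r) as [<- |]; auto.
         rewrite (spec_term_not_sqf m s Q) by (auto; lia). reflexivity. }
  destruct (in_dec Nat.eq_dec r (sqf Q)) as [Hir | Hir].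
  2: { replace (if (q =? r)%nat then spec_term m s r else C0) with C0.
       - apply Hzero. intros n. rewrite (coef_not_sqf Q r) by (auto; lia). ring.
       - destruct (Nat.eqb_spec q r) as [<- |]; tauto. }
  apply has_mean_ext with (fun n => Cmul (Cmul (coef s q) (coef (Cconj s) r))
                                         (Cmul (ramanujan q n) (ramanujan r (n + m)))).
  { intros n. ring. }
  replace (if (q =? r)%nat then spec_term m s r else C0) with
    (Cmul (Cmul (coef s q) (coef (Cconj s) r)) (if (q =? r)%nat then ramanujan r m else C0)).
  - apply has_mean_scal. now apply (ramanujan_correlation Q).
  (* On the diagonal the conjugate of s turns the product of the two coefficients into a squared
     modulus. *)
  - destruct (Nat.eqb_spec q r) as [<- |]; [| ring].
    unfold spec_term. f_equal. rewrite coef_conj. generalize (coef s q). intros z.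
    apply Cx_eq; simpl; unfold Cnorm2; ring.
Qed.

(** The shifted sum is part of the unshifted one up to N + m. *)
Lemma sigma_neg_shift_mean_square del m N : 0 < del ->
  rsum (seq 1 N) (fun n => sigma_neg del (n + m) * sigma_neg del (n + m))
  <= (1 + / del) ^ 3 * (INR N + INR m).
Proof.
  intros Hdel.
  rewrite <- (rsum_map (fun n => (n + m)%nat) (seq 1 N)
                (fun n => sigma_neg del n * sigma_neg del n)).
  rewrite <- plus_INR. eapply Rle_trans; [| now apply sigma_neg_mean_square].
  apply rsum_incl.
  - apply FinFun.Injective_map_NoDup; [intros x y; lia | apply seq_NoDup].
  - intros x Hx. apply in_map_iff in Hx. destruct Hx as [y [<- Hy]].
    apply in_seq in Hy. apply in_seq. lia.
  - intros x _. apply Rle_0_sqr.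
Qed.

Lemma nat_floor x : 0 <= x ->
  INR (Z.to_nat (Int_part x)) <= x < INR (Z.to_nat (Int_part x)) + 1.
Proof.
  intros Hx. pose proof (base_Int_part x) as [H1 H2].
  assert (0 <= Int_part x)%Z.
  { apply Z.lt_succ_r. apply lt_IZR. rewrite succ_IZR. lra. }
  rewrite INR_IZR_INZ, Z2Nat.id by auto. lra.
Qed.

(** The long hypothesis is the conclusion of [f_approx] for a given A, since [avg_limit] chooses Q
    in terms of that same A. *)
Lemma avg_tail_bound del A m s Q N :
  0 < del -> 0 < A -> (1 <= Q)%nat -> Re s = 1 + 3 * del ->
  (forall s n, Re s = 1 + 3 * del -> (1 <= n)%nat ->
    Cmod (f n s) <= A * sigma_neg del n /\
    forall Q, (1 <= Q)%nat ->
      Cmod (Cpsum (f_term s n) Q) <= A * sigma_neg del n /\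
      Cmod (Csub (Cpsum (f_term s n) Q) (f n s)) <= A * sigma_neg del n * pw Q (- del)) ->
  Cmod (Csub (csum (seq 1 N) (fun n => Cmul (f n s) (f (n + m) (Cconj s))))
             (csum (seq 1 N) (fun n =>
               Cmul (Cpsum (f_term s n) Q) (Cpsum (f_term (Cconj s) (n + m)) Q))))
  <= A * A * (1 + / del) ^ 3 * pw Q (- del) * (2 * INR N + INR m).
Proof.
  intros Hdel HA HQ Hs Hf. rewrite <- csum_sub.
  eapply Rle_trans; [apply csum_mod |].
  set (sg := sigma_neg del). set (w := pw Q (- del)).
  assert (0 < w) by apply pw_pos.
  apply Rle_trans with (rsum (seq 1 N) (fun n => A * A * w *
    (sg n * sg n + sg (n + m)%nat * sg (n + m)%nat))).
  - apply rsum_le. intros n Hn. apply in_seq in Hn.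
    destruct (Hf s n Hs ltac:(lia)) as [_ H2]. destruct (H2 Q HQ) as [H3 H4].
    destruct (Hf (Cconj s) (n + m)%nat Hs ltac:(lia)) as [H5 H6]. destruct (H6 Q HQ) as [_ H8].
    fold sg w in H3, H4, H5, H8.
    set (F := f n s) in *. set (G := f (n + m) (Cconj s)) in *.
    set (FQ := Cpsum (f_term s n) Q) in *. set (GQ := Cpsum (f_term (Cconj s) (n + m)) Q) in *.
    replace (Csub (Cmul F G) (Cmul FQ GQ)) with
      (Copp (Cadd (Cmul (Csub FQ F) G) (Cmul FQ (Csub GQ G)))) by ring.
    rewrite Cmod_opp. eapply Rle_trans; [apply Cmod_add |]. rewrite !Cmod_mul.
    apply Rle_trans with ((A * sg n * w) * (A * sg (n + m)%nat)
                          + (A * sg n) * (A * sg (n + m)%nat * w)).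
    + apply Rplus_le_compat; apply Rmult_le_compat; auto; apply Cmod_ge0.
    + replace (_ + _) with (A * A * w * (2 * (sg n * sg (n + m)%nat))) by ring.
      (* By 2 a b <= a^2 + b^2 the product of the two divisor functions reduces to mean squares. *)
      apply Rmult_le_compat_l; [repeat apply Rmult_le_pos; lra |].
      pose proof (Rle_0_sqr (sg n - sg (n + m)%nat)) as Hsq. unfold Rsqr in Hsq. lra.
  - rewrite rsum_scal, rsum_add.
    pose proof (sigma_neg_mean_square del N Hdel). pose proof (sigma_neg_shift_mean_square del m N Hdel).
    apply Rle_trans with (A * A * w * ((1 + / del) ^ 3 * INR N + (1 + / del) ^ 3 * (INR N + INR m))).
    + apply Rmult_le_compat_l; [repeat apply Rmult_le_pos; lra |]. unfold sg. lra.
    + right. ring.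
Qed.

Lemma avg_limit m s : (1 <= m)%nat -> 1 < Re s ->
  forall eps, eps > 0 -> exists X, forall x, X <= x ->
    Cmod (Csub (avg m s x) (Fspec m s)) < eps.
Proof.
  intros Hm Hs eps Heps.
  set (del := (Re s - 1) / 3). assert (0 < del) as Hdel by (unfold del; lra).
  assert (Re s = 1 + 3 * del) as Hsd by (unfold del; lra).
  destruct (f_approx del Hdel) as [A [HA Hf]].
  destruct (spec_majorant m Hm) as [v [T [HT Hv]]]. specialize (Hv s ltac:(lra)).
  assert (0 < 1 / 4) as H4 by lra.
  pose proof (majorant_bound_ge0 v T HT) as HT0.
  set (K := A * A * (1 + / del) ^ 3).
  assert (0 < K) as HK.
  { pose proof (Rinv_0_lt_compat del Hdel). unfold K.
    repeat apply Rmult_lt_0_compat; try apply pow_lt; lra. }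
  (* The 3 comes from 2 N + m <= 3 x once x >= m. [Q1] controls the truncation of f, [Q2] that of
     the spectrum. *)
  destruct (pw_vanish del (K * 3) (eps / 3) Hdel ltac:(lra) ltac:(lra)) as [Q1 [_ HQ1]].
  destruct (pw_vanish (1 / 4) (2 * T) (eps / 3) H4 ltac:(lra) ltac:(lra)) as [Q2 [_ HQ2]].
  set (Q := S (max Q1 Q2)).
  specialize (HQ1 Q ltac:(lia)). specialize (HQ2 Q ltac:(lia)).
  destruct (truncated_mean m s Q) as [B HB].
  pose proof (Cseries_tail _ v (1 / 4) T H4 Hv HT Q ltac:(lia)) as Htail.
  change (Cseries (spec_term m s)) with (Fspec m s) in Htail.
  set (M := Cpsum (spec_term m s) Q) in *. set (F := Fspec m s) in *.
  (* The second bound absorbs two O(1) errors: B in the truncated mean, and [Cmod M] from replacing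
     the floor N by x. *)
  exists (Rmax (INR m) (3 * (B + Cmod M) / eps + 1)). intros x Hx.
  assert (INR m <= x) by (eapply Rle_trans; [apply Rmax_l | exact Hx]).
  assert (3 * (B + Cmod M) / eps + 1 <= x) as Hx2 by (eapply Rle_trans; [apply Rmax_r | exact Hx]).
  assert (1 <= INR m) by (apply (le_INR 1); auto).
  assert (B + Cmod M < eps / 3 * x) as Hx3.
  { apply Rmult_lt_reg_r with (3 / eps); [apply Rdiv_lt_0_compat; lra |].
    replace (eps / 3 * x * (3 / eps)) with x by (field; lra).
    replace ((B + Cmod M) * (3 / eps)) with (3 * (B + Cmod M) / eps) by (field; lra). lra. }
  destruct (nat_floor x ltac:(lra)) as [HN1 HN2].
  unfold avg. set (N := Z.to_nat (Int_part x)) in *.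
  change (Csum_list (map (fun n => Cmul (f n s) (f (n + m) (Cconj s))) (seq 1 N)))
    with (csum (seq 1 N) (fun n => Cmul (f n s) (f (n + m) (Cconj s)))).
  set (G := csum (seq 1 N) (fun n => Cmul (f n s) (f (n + m) (Cconj s)))).
  pose proof (avg_tail_bound del A m s Q N Hdel HA ltac:(lia) Hsd Hf) as Hdiff.
  fold G in Hdiff. fold K in Hdiff. specialize (HB N).
  set (GQ := csum (seq 1 N) (fun n => Cmul (Cpsum (f_term s n) Q)
    (Cpsum (f_term (Cconj s) (n + m)) Q))) in *.
  replace (Csub (Cmul (RtoC (/ x)) G) F) with (Cmul (RtoC (/ x)) (Csub G (Cmul (RtoC x) F))).
  2: { replace F with (Cmul (RtoC (/ x * x)) F) at 2
         by (rewrite Rinv_l by lra; fold C1; ring). rewrite RtoC_mul. ring. }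
  rewrite Cmod_mul, Cmod_RtoC, Rabs_pos_eq by (apply Rlt_le, Rinv_0_lt_compat; lra).
  apply Rmult_lt_reg_l with x; [lra |].
  rewrite <- Rmult_assoc, Rinv_r, Rmult_1_l by lra.
  (* Four errors: truncation of f, the mean of the truncated product, the floor of x, and the tail
     of the spectrum. *)
  replace (Csub G (Cmul (RtoC x) F)) with
    (Cadd (Cadd (Csub G GQ) (Csub GQ (Cmul (RtoC (INR N)) M)))
       (Cadd (Cmul (RtoC (INR N - x)) M) (Cmul (RtoC x) (Csub M F))))
    by (rewrite RtoC_sub; ring).
  eapply Rle_lt_trans; [apply Cmod_add |].
  pose proof (Cmod_add (Csub G GQ) (Csub GQ (Cmul (RtoC (INR N)) M))) as Ha.
  pose proof (Cmod_add (Cmul (RtoC (INR N - x)) M) (Cmul (RtoC x) (Csub M F))) as Hb.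
  rewrite !Cmod_mul, !Cmod_RtoC in Hb. rewrite (Rabs_pos_eq x) in Hb by lra.
  assert (Rabs (INR N - x) * Cmod M <= 1 * Cmod M) as Hc.
  { apply Rmult_le_compat_r; [apply Cmod_ge0 |]. apply Rabs_le. lra. }
  assert (x * Cmod (Csub M F) <= x * (eps / 3)) as Hd by (apply Rmult_le_compat_l; lra).
  assert (K * pw Q (- del) * (2 * INR N + INR m) <= K * pw Q (- del) * (3 * x)) as He.
  { apply Rmult_le_compat_l; [| lra]. apply Rmult_le_pos; [lra | apply Rlt_le, pw_pos]. }
  assert (K * pw Q (- del) * (3 * x) <= x * (eps / 3)) as Hg.
  { replace (K * pw Q (- del) * (3 * x)) with (x * (K * 3 * pw Q (- del))) by ring.
    apply Rmult_le_compat_l; lra. }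
  lra.
Qed.

(** * The Euler product *)

Lemma euler_partial_S m sigma N : euler_partial m sigma (S N) =
  (if is_prime (S N) then euler_factor m sigma (S N) else 1) * euler_partial m sigma N.
Proof.
  unfold euler_partial. rewrite seq_S, filter_app, map_app, fold_right_app. simpl plus.
  set (l := map _ (filter is_prime (seq 1 N))).
  assert (forall l a, fold_right Rmult a l = a * fold_right Rmult 1 l) as H.
  { clear. induction l as [|x l IH]; intros a; simpl; [ring |]. rewrite IH. ring. }
  rewrite (H l). f_equal. simpl filter. destruct (is_prime (S N)); simpl; ring.
Qed.

(** The terms are multiplicative, and [euler_factor - 1] is the term at the prime, namely c_p(m) /
    (p^(2 sigma - 2) (p - 1)^2). *)
Lemma spec_term_mul m s P k :
  is_prime (S P) = true -> In k (sqf P) ->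
  spec_term m s (S P * k) = Cmul (RtoC (euler_factor m (Re s) (S P) - 1)) (spec_term m s k).
Proof.
  intros Hp Hk. assert (Nat.gcd (S P) k = 1%nat) as Hg by (apply (sqf_coprime P); auto).
  assert (In (S P * k)%nat (sqf (S P))) as Hpk by (apply in_sqf_S; eauto).
  pose proof (sqf_pos P k Hk) as Hk1.
  unfold spec_term. rewrite <- !Cmod_sqr.
  rewrite (Cmod_coef (S P)), (Cmod_coef P k), (ramanujan_sqf_mul P), (totient_sqf_mul P) by auto.
  rewrite pw_mul by lia.
  assert (2 <= INR (S P)) by (apply (le_INR 2), prime_ge2; auto).
  pose proof (totient_pos k Hk1). unfold euler_factor.
  set (p := S P) in *.
  replace (Rpower (INR p) (2 * Re s - 2)) with (pw p (Re s - 1) * pw p (Re s - 1)).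
  2: { rewrite <- pw_add. unfold pw. f_equal. ring. }
  pose proof (pw_pos p (Re s - 1)). pose proof (pw_pos k (Re s - 1)).
  generalize (ramanujan k m); intros z.
  set (a := pw p (Re s - 1)) in *. set (b := pw k (Re s - 1)) in *.
  set (t := INR (totient k)) in *. clearbody p a b t. unfold dvd.
  destruct (m mod p =? 0)%nat; apply Cx_eq; simpl; field; lra.
Qed.

(** Expanding the finite product gives exactly the terms over [sqf N]; this identity involves no
    convergence. *)
Lemma csum_sqf_spec m s N : csum (sqf N) (spec_term m s) = RtoC (euler_partial m (Re s) N).
Proof.
  induction N as [|N IH].
  - change (sqf 0) with (1%nat :: nil). rewrite csum_cons. change (csum nil _) with C0.
    unfold spec_term. rewrite <- Cmod_sqr, (Cmod_coef 0) by (now left).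
    rewrite pw_one, totient_1, ramanujan_1, Rmult_1_r, Rinv_1, Rmult_1_r.
    change (euler_partial m (Re s) 0) with 1. fold C1. ring.
  - rewrite euler_partial_S, RtoC_mul, <- IH.
    change (sqf (S N)) with
      (if is_prime (S N) then sqf N ++ map (Nat.mul (S N)) (sqf N) else sqf N).
    destruct (is_prime (S N)) eqn:Hp.
    + rewrite csum_app, csum_map.
      rewrite (csum_ext (sqf N) (fun k => spec_term m s (S N * k))
        (fun k => Cmul (RtoC (euler_factor m (Re s) (S N) - 1)) (spec_term m s k)))
        by (intros; now apply spec_term_mul).
      rewrite csum_scal, RtoC_sub. fold C1. ring.
    + fold C1. ring.
Qed.

Lemma csum_sublist l K (u : nat -> Cx) : NoDup l -> (forall q, In q l -> (1 <= q <= K)%nat) ->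
  csum l u = csum (seq 1 K) (fun q => if in_dec Nat.eq_dec q l then u q else C0).
Proof.
  intros Hn Hl.
  transitivity (csum (filter (fun q => if in_dec Nat.eq_dec q l then true else false) (seq 1 K)) u).
  - apply csum_perm, NoDup_Permutation; auto; [apply NoDup_filter, seq_NoDup |].
    intros q. rewrite filter_In, in_seq. destruct (in_dec Nat.eq_dec q l).
    + split; auto. intros _. specialize (Hl q i). split; auto; lia.
    + split; [tauto | intros [_ H]; discriminate].
  - rewrite csum_filter. apply csum_ext. intros q _. now destruct (in_dec Nat.eq_dec q l).
Qed.

Lemma sqf_bounded P : exists K, forall q, In q (sqf P) -> (q <= K)%nat.
Proof.
  exists (list_max (sqf P)). apply Forall_forall. now apply list_max_le.
Qed.

Lemma euler_product_cv m s : (1 <= m)%nat -> 1 <= Re s ->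
  C_cv (fun N => RtoC (euler_partial m (Re s) N)) (Fspec m s).
Proof.
  intros Hm Hs. destruct (spec_majorant m Hm) as [v [T [HT Hv]]]. specialize (Hv s Hs).
  assert (0 < 1 / 4) as H4 by lra.
  pose proof (majorant_bound_ge0 v T HT) as HT0.
  intros eps Heps.
  (* Here 3 T = 2 T + T: the tail of the series beyond K, and the terms up to K missing from
     [sqf N]. *)
  destruct (pw_vanish (1 / 4) (3 * T) eps H4 ltac:(lra) ltac:(lra)) as [N0 [HN0 HN]].
  exists N0. intros N HNN. specialize (HN N HNN). rewrite <- csum_sqf_spec.
  destruct (sqf_bounded N) as [K0 HK0]. set (K := max K0 N).
  eapply Rle_lt_trans; [apply (Cmod_sub_trans _ (Cpsum (spec_term m s) K)) |].
  pose proof (Cseries_tail _ v (1 / 4) T H4 Hv HT K ltac:(lia)) as Htail.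
  change (Cseries (spec_term m s)) with (Fspec m s) in Htail.
  assert (pw K (- (1 / 4)) <= pw N (- (1 / 4))) by (apply pw_anti; [lia | lra]).
  assert (2 * T * pw K (- (1 / 4)) <= 2 * T * pw N (- (1 / 4)))
    by (apply Rmult_le_compat_l; lra).
  assert (Cmod (Csub (csum (sqf N) (spec_term m s)) (Cpsum (spec_term m s) K))
          <= T * pw N (- (1 / 4))); [| lra].
  rewrite Cmod_sub_sym.
  rewrite (csum_sublist (sqf N) K) by
    (auto using sqf_NoDup; intros q Hq; pose proof (sqf_pos N q Hq); specialize (HK0 q Hq); lia).
  change (Cpsum (spec_term m s) K) with (csum (seq 1 K) (spec_term m s)).
  rewrite <- csum_sub. eapply Rle_trans; [apply csum_mod |].
  apply Rle_trans with (rsum (seq 1 K) (fun q => pw N (- (1 / 4)) * v q)).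
  - apply rsum_le. intros q Hq. apply in_seq in Hq.
    assert (0 <= pw N (- (1 / 4)) * v q).
    { apply Rmult_le_pos; [apply Rlt_le, pw_pos |].
      apply (majorant_ge0 (spec_term m s) v (1 / 4)); auto. lia. }
    destruct (in_dec Nat.eq_dec q (sqf N)) as [Hi | Hi].
    + replace (Csub _ _) with C0 by ring. now rewrite Cmod_C0.
    + replace (Csub (spec_term m s q) C0) with (spec_term m s q) by ring.
      (* A missing q <= N is not squarefree and contributes 0, so only q > N matters. *)
      destruct (le_lt_dec q N) as [HqN | HqN].
      * rewrite (spec_term_not_sqf m s N) by (auto; lia). now rewrite Cmod_C0.
      * apply (term_le (spec_term m s) v (1 / 4)); auto. lia.
  - rewrite rsum_scal, Rmult_comm. apply Rmult_le_compat_r; auto. apply Rlt_le, pw_pos.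
Qed.

(** * Bounds for the Euler factors and partial products *)

Lemma euler_factor_dvd m sigma p : Nat.divide p m ->
  euler_factor m sigma p = 1 + / (Rpower (INR p) (2 * sigma - 2) * (INR p - 1)).
Proof. intros H. unfold euler_factor. apply dvd_iff in H. unfold dvd in H. now rewrite H. Qed.

Lemma euler_factor_not_dvd m sigma p : ~ Nat.divide p m ->
  euler_factor m sigma p = 1 - / (Rpower (INR p) (2 * sigma - 2) * (INR p - 1) ^ 2).
Proof.
  intros H. unfold euler_factor. rewrite <- dvd_iff in H. unfold dvd in H.
  apply not_true_iff_false in H. now rewrite H.
Qed.

Lemma inv_le_inv1 w x : 1 <= w -> 0 < x -> 0 < / (w * x) <= / x.
Proof.
  intros Hw Hx. split; [apply Rinv_0_lt_compat; nra |].
  apply Rinv_le_contravar; nra.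
Qed.

Lemma euler_factor_ge m sigma p : 1 <= sigma -> (2 <= p)%nat ->
  1 - / (INR p - 1) ^ 2 <= euler_factor m sigma p.
Proof.
  intros Hs Hp. assert (2 <= INR p) by (now apply (le_INR 2)).
  assert (1 <= Rpower (INR p) (2 * sigma - 2)) as Hw by (apply pw_ge1; [lia | lra]).
  assert (0 < (INR p - 1) ^ 2) as Hx by (apply pow_lt; lra).
  pose proof (Rinv_0_lt_compat _ Hx).
  destruct (classic (Nat.divide p m)).
  - rewrite euler_factor_dvd by auto.
    pose proof (inv_le_inv1 _ (INR p - 1) Hw ltac:(lra)). lra.
  - rewrite euler_factor_not_dvd by auto. pose proof (inv_le_inv1 _ _ Hw Hx). lra.
Qed.

(* For even [m] the factor at 2 is at least 1, and the remaining ones are compared with the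
   telescoping product of [1 - 1/k^2] over [2 <= k <= N], which is [(N+1)/(2N)]. *)
Lemma euler_partial_even m sigma N : Nat.even m = true -> 1 <= sigma ->
  INR (S (S N)) / (2 * INR (S N)) <= euler_partial m sigma (S (S N)).
Proof.
  intros Hm Hs. induction N as [|N IH].
  - rewrite euler_partial_S. change (is_prime 2) with true.
    change (euler_partial m sigma 1) with 1.
    rewrite euler_factor_dvd.
    + assert (1 <= Rpower (INR 2) (2 * sigma - 2)) as Hw by (apply pw_ge1; [lia | lra]).
      simpl INR in *. pose proof (inv_le_inv1 _ (1 + 1 - 1) Hw ltac:(lra)). lra.
    + apply Nat.even_spec in Hm. destruct Hm as [z ->]. exists z. lia.
  - rewrite euler_partial_S. set (n := S (S N)) in *.
    assert (2 <= INR n) as Hn by (apply (le_INR 2); lia).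
    assert (INR (S N) = INR n - 1) as HN by (unfold n; rewrite (S_INR (S N)); ring).
    rewrite HN in IH. rewrite S_INR.
    assert (1 - / INR n ^ 2 <= (if is_prime (S n) then euler_factor m sigma (S n) else 1)) as Hf.
    { destruct (is_prime (S n)).
      - replace (INR n) with (INR (S n) - 1) by (rewrite S_INR; ring).
        apply euler_factor_ge; auto. lia.
      - assert (0 < / INR n ^ 2) by (apply Rinv_0_lt_compat, pow_lt; lra). lra. }
    (* The telescoping identity (1 - 1/n^2) n / (2 (n-1)) = (n+1) / (2 n); a composite n + 1 has
       factor 1, which exceeds 1 - 1/n^2. *)
    apply Rle_trans with ((1 - / INR n ^ 2) * (INR n / (2 * (INR n - 1)))).
    + right. field. lra.
    + apply Rmult_le_compat; auto.
      * assert (/ INR n ^ 2 <= / 1) by (apply Rinv_le_contravar; nra). lra.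
      * apply Rlt_le, Rdiv_lt_0_compat; lra.
Qed.

Lemma euler_factor_abs m sigma p : (1 <= m)%nat -> 1 <= sigma -> (2 <= p)%nat ->
  Rabs (euler_factor m sigma p) <= if (p <=? m)%nat then 2 else 1.
Proof.
  intros Hm Hs Hp. assert (2 <= INR p) by (now apply (le_INR 2)).
  assert (1 <= Rpower (INR p) (2 * sigma - 2)) as Hw by (apply pw_ge1; [lia | lra]).
  destruct (classic (Nat.divide p m)) as [Hd | Hd].
  - rewrite euler_factor_dvd by auto. apply Nat.divide_pos_le in Hd; [| lia].
    apply Nat.leb_le in Hd. rewrite Hd.
    pose proof (inv_le_inv1 _ (INR p - 1) Hw ltac:(lra)).
    assert (/ (INR p - 1) <= / 1) by (apply Rinv_le_contravar; lra).
    apply Rabs_le. lra.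
  - rewrite euler_factor_not_dvd by auto.
    pose proof (inv_le_inv1 _ ((INR p - 1) ^ 2) Hw ltac:(nra)).
    assert (/ (INR p - 1) ^ 2 <= / 1) by (apply Rinv_le_contravar; nra).
    apply Rle_trans with 1; [apply Rabs_le; lra |]. destruct (p <=? m)%nat; lra.
Qed.

(** The factor at 2 is at most 2 sigma - 2. Any later factor exceeding 1 in modulus belongs to some
    p <= m and is at most 2, so the product of these stays below 2^m uniformly in N and sigma. *)
Lemma euler_partial_odd m sigma N : (1 <= m)%nat -> Nat.odd m = true -> 1 <= sigma ->
  Rabs (euler_partial m sigma (S (S N))) <= 2 ^ min (S (S N)) m * (2 * sigma - 2).
Proof.
  intros Hm Hodd Hs. induction N as [|N IH].
  - rewrite euler_partial_S. change (is_prime 2) with true.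
    change (euler_partial m sigma 1) with 1.
    rewrite euler_factor_not_dvd, Rmult_1_r.
    + simpl INR. replace ((1 + 1 - 1) ^ 2) with 1 by ring. rewrite Rmult_1_r.
      replace (1 + 1) with 2 by ring.
      rewrite <- Rpower_Ropp. unfold Rpower.
      assert (0 < ln 2 < 1) as Hln.
      { split; [pose proof ln_lt_2; lra |]. rewrite <- (ln_exp 1).
        apply ln_increasing; [lra |]. pose proof (exp_ineq1 1 ltac:(lra)). lra. }
      (* This gives 1 - 2^(-(2 sigma - 2)) <= (2 sigma - 2) ln 2, and ln 2 < 1. *)
      pose proof (exp_ineq1_le (- (2 * sigma - 2) * ln 2)).
      assert (exp (- (2 * sigma - 2) * ln 2) <= 1).
      { rewrite <- exp_0. apply Rnot_lt_le. intros Hlt. apply exp_lt_inv in Hlt. nra. }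
      assert (1 <= 2 ^ min 2 m) by (apply pow_R1_Rle; lra).
      rewrite Rabs_pos_eq by lra. nra.
    + intros [z ->]. rewrite Nat.odd_mul, andb_comm in Hodd. discriminate.
  - rewrite euler_partial_S, Rabs_mult. set (n := S (S N)) in *.
    assert (2 ^ min n m <= 2 ^ min (S n) m) by (apply Rle_pow; [lra | lia]).
    destruct (is_prime (S n)) eqn:Hp.
    + pose proof (euler_factor_abs m sigma (S n) Hm Hs (prime_ge2 _ Hp)) as Hf.
      destruct (Nat.leb_spec (S n) m).
      * replace (min (S n) m) with (S (min n m)) by lia.
        change (2 ^ S (min n m)) with (2 * 2 ^ min n m). rewrite Rmult_assoc.
        apply Rmult_le_compat; auto using Rabs_pos.
      * replace (min (S n) m) with (min n m) by lia.
        rewrite <- (Rmult_1_l (2 ^ min n m * _)).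
        apply Rmult_le_compat; auto using Rabs_pos.
    + rewrite Rabs_R1, Rmult_1_l. apply Rle_trans with (1 := IH).
      apply Rmult_le_compat_r; lra.
Qed.

Theorem theorem7p1 (m : nat) (hm : (1 <= m)%nat) :
  (forall s : Cx, 1 < Re s ->
     (* F(sigma) = lim_{x -> oo} (1/x) sum_{n<=x} f(n,s) f(n+m, conj s) = sum_q |..|^2 c_q(m) *)
     (forall eps, eps > 0 -> exists X, forall x, X <= x ->
        Cmod (Csub (avg m s x) (Fspec m s)) < eps) /\
     (* product decomposition *)
     C_cv (fun N => RtoC (euler_partial m (Re s) N)) (Fspec m s)) /\
  (* (1) m odd: F(sigma) -> 0 as sigma -> 1+ *)
  (Nat.odd m = true ->
     forall eps, eps > 0 -> exists delta, delta > 0 /\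
       forall sigma, 1 < sigma < 1 + delta -> Cmod (Fspec m (sigma, 0)) < eps) /\
  (* (2) m >= 2 even, sigma >= 1: F(sigma) >= 1/2 *)
  ((2 <= m)%nat -> Nat.even m = true ->
     forall sigma, 1 <= sigma ->
       Im (Fspec m (sigma, 0)) = 0 /\ Re (Fspec m (sigma, 0)) >= 1 / 2).
Proof.
  assert (forall sigma, 1 <= sigma -> forall eps, eps > 0 -> exists N,
    Cmod (Csub (RtoC (euler_partial m sigma (S (S N)))) (Fspec m (sigma, 0))) < eps) as Hcv.
  { intros sigma Hs eps He. destruct (euler_product_cv m (sigma, 0) hm Hs eps He) as [N HN].
    exists N. apply HN. lia. }
  split; [| split].
  - intros s Hs. split; [now apply avg_limit | apply euler_product_cv; auto; lra].
  - intros Hodd eps He.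
    assert (0 < 2 ^ m) as H2 by (apply pow_lt; lra).
    (* With this delta, 2^m (2 sigma - 2) < eps / 2; the other half covers the distance from the
       partial product to the limit. *)
    exists (eps / (4 * 2 ^ m)). split; [apply Rdiv_lt_0_compat; lra |].
    intros sigma Hs. destruct (Hcv sigma ltac:(lra) (eps / 2) ltac:(lra)) as [N HN].
    pose proof (euler_partial_odd m sigma N hm Hodd ltac:(lra)) as Ho.
    set (E := euler_partial m sigma (S (S N))) in *.
    assert (2 ^ min (S (S N)) m * (2 * sigma - 2) <= 2 ^ m * (2 * sigma - 2)).
    { apply Rmult_le_compat_r; [lra |]. apply Rle_pow; [lra | lia]. }
    assert (2 ^ m * (2 * sigma - 2) < eps / 2).
    { replace (eps / 2) with (2 ^ m * (2 * (eps / (4 * 2 ^ m)))) by (field; lra).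
      apply Rmult_lt_compat_l; lra. }
    replace (Fspec m (sigma, 0)) with (Csub (RtoC E) (Csub (RtoC E) (Fspec m (sigma, 0)))) by ring.
    eapply Rle_lt_trans; [apply Cmod_sub |]. rewrite Cmod_RtoC. lra.
  - intros _ Heven sigma Hs. set (F := Fspec m (sigma, 0)) in *. split.
    (* The partial products are real, so none comes closer to F than |Im F|, which contradicts
       convergence with that value as epsilon. *)
    + apply NNPP. intros HF. apply Rabs_pos_lt in HF.
      destruct (Hcv sigma Hs _ HF) as [N HN]. fold F in HN.
      set (E := euler_partial m sigma (S (S N))) in *.
      pose proof (Rabs_snd_le (Csub (RtoC E) F)) as H.
      replace (snd (Csub (RtoC E) F)) with (- Im F) in H by (unfold Im; simpl; ring).
      rewrite Rabs_Ropp in H. lra.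
    + apply Rle_ge, le_epsilon. intros eps He.
      destruct (Hcv sigma Hs eps He) as [N HN]. fold F in HN.
      pose proof (euler_partial_even m sigma N Heven Hs) as HE.
      set (E := euler_partial m sigma (S (S N))) in *.
      pose proof (Rabs_fst_le (Csub (RtoC E) F)) as H.
      change (fst (Csub (RtoC E) F)) with (E - fst F) in H.
      assert (1 / 2 <= E).
      { apply Rle_trans with (2 := HE). rewrite (S_INR (S N)).
        assert (0 < INR (S N)) by (apply lt_0_INR; lia).
        apply Rmult_le_reg_r with (2 * INR (S N)); [lra |].
        unfold Rdiv. rewrite (Rmult_assoc (INR (S N) + 1)), Rinv_l by lra. lra. }
      pose proof (Rle_abs (E - fst F)). unfold Re. lra.
Qed.
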